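(* Let $\Omega \subset \mathbb{R}^n$, $n\geq 2$, be a bounded, convex domain which satisfies the interior sphere property. Let $q\in (\frac{1}{3},1)$ and $p\in (\frac{3q-1}{2},q)$. Let $u\in C^2_x(\Omega)\cap C^1_x(\overline{\Omega}) \cap C^1_t((0,+\infty)) \cap C(\overline{\Omega}\times [0,+\infty))$ be a positive solution of $$\begin{cases} u_t-\Delta u= a(x) u^p+u^q &\text{in }\Omega\times (0,+\infty), \\ u=0 & \text{on }\partial \Omega\times [0,+\infty), \\ u =0 & \text{on } \overline{\Omega} \times \{0\}. \end{cases}$$ Suppose $a\colon \Omega \to \mathbb{R}$ is measurable and that there exists $m>0$ such that $a(x)\geq m$ for all $x\in \Omega$; assume moreover $a$ to be $\theta$-concave with $\theta \in [\frac{1-q}{2(q-p)}, +\infty]$. Then $(x,t)\mapsto u(x, t^{2})$ is $\frac{1-q}{2}$-concave.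
   Context: $\Omega$ (open) satisfies the interior sphere property if for all $x\in\partial\Omega$ there exist $y\in\Omega$ and $r>0$ such that $B_r(y)\subseteq\Omega$ and $x\in\partial B_r(y)$. $u\in C^k_x(A)$ means $u(\cdot,t)\in C^k(A)$ for each $t>0$; $u\in C^1_t((0,+\infty))$ means $u(x,\cdot)\in C^1((0,+\infty))$ for each $x\in\Omega$. A solution is positive when $u>0$ in $\Omega\times(0,+\infty)$. For $0<\alpha<+\infty$, a nonnegative function $w$ on a convex set is $\alpha$-concave if $w^\alpha$ is concave (for functions of $(x,t)$, jointly in $(x,t)$); $w$ is $(+\infty)$-concave if $w$ is constant. *)

(* Defs.v *)
From HB Require Import structures.
From mathcomp Require Import all_boot all_order all_algebra.
From mathcomp Require Import all_classical all_reals all_analysis.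

Set Implicit Arguments.
Unset Strict Implicit.
Unset Printing Implicit Defensive.

Import Order.TTheory GRing.Theory Num.Theory.
Import numFieldNormedType.Exports.

Local Open Scope classical_set_scope.
Local Open Scope ring_scope.

(* The library norm on ['rV[R]_n] is the sup norm; the interior sphere property
   needs Euclidean balls. *)
Definition enorm (R : realType) (n : nat) (x : 'rV[R]_n) : R :=
  Num.sqrt (\sum_(i < n) x ord0 i ^+ 2).

Definition eball (R : realType) (n : nat) (y : 'rV[R]_n) (r : R) :
    set 'rV[R]_n :=
  [set x | enorm (x - y) < r].

Definition boundary (T : topologicalType) (A : set T) : set T :=
  closure A `\` interior A.

Definition domain (T : topologicalType) (Omega : set T) : Prop :=
  [/\ open Omega, connected Omega & Omega !=set0].

Definition interior_sphere (R : realType) (n : nat) (Omega : set 'rV[R]_n) :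
    Prop :=
  forall x, boundary Omega x ->
    exists (y : 'rV[R]_n) (r : R),
      [/\ Omega y, 0 < r, eball y r `<=` Omega & boundary (eball y r) x].

Definition partial (R : realType) (n : nat) (i : 'I_n) (f : 'rV[R]_n -> R) :
    'rV[R]_n -> R :=
  fun x => 'D_(delta_mx ord0 i) f x.

Definition laplacian (R : realType) (n : nat) (f : 'rV[R]_n -> R)
    (x : 'rV[R]_n) : R :=
  \sum_(i < n) partial i (partial i f) x.

(* Meant for open [Omega]: derivatives at a point of [Omega] then only depend
   on the values of [f] in [Omega]. *)
Fixpoint Ck (R : realType) (n k : nat) (Omega : set 'rV[R]_n)
    (f : 'rV[R]_n -> R) : Prop :=
  {within Omega, continuous f} /\
  match k with
  | 0%N => True
  | k'.+1 => forall i : 'I_n,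
      (forall x, Omega x -> derivable f x (delta_mx ord0 i)) /\
      Ck k' Omega (partial i f)
  end.

(* C^1 up to the boundary: [f] is continuous on the closure, and its first
   partial derivatives in [Omega] extend continuously to the closure. *)
Definition C1_closure (R : realType) (n : nat) (Omega : set 'rV[R]_n)
    (f : 'rV[R]_n -> R) : Prop :=
  [/\ Ck 1 Omega f,
      {within closure Omega, continuous f} &
      forall i : 'I_n, exists g : 'rV[R]_n -> R,
        {within closure Omega, continuous g} /\
        {in Omega, g =1 partial i f}].

Definition C1_pos (R : realType) (f : R -> R) : Prop :=
  (forall t, 0 < t -> derivable f t 1) /\
  {within `]0, +oo[, continuous (derive1 f)}.

Definition box (R : realType) (n : nat) (l h : 'rV[R]_n) : set 'rV[R]_n :=
  [set x | forall i, l ord0 i <= x ord0 i <= h ord0 i].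

Definition lebesgue_outer (R : realType) (n : nat) (X : set 'rV[R]_n) :
    \bar R :=
  ereal_inf [set s | exists l h : nat -> 'rV[R]_n,
    [/\ forall k i, l k ord0 i <= h k ord0 i,
        X `<=` \bigcup_k box (l k) (h k) &
        s = (\sum_(0 <= k <oo) (\prod_(i < n) (h k ord0 i - l k ord0 i))%:E)%E]].

Definition lebesgue_measurable_on (R : realType) (n : nat)
    (Omega : set 'rV[R]_n) (a : 'rV[R]_n -> R) : Prop :=
  forall B : set R, measurable B ->
    caratheodory_measurable (@lebesgue_outer R n) (Omega `&` a @^-1` B).

Definition concave_function (R : realType) (E : lmodType R) (D : set E)
    (f : E -> R) : Prop :=
  @convex_function R E D (fun x => - f x).

(* [alpha = -oo] and [alpha <= 0] are outside the range of the notion. *)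
Definition power_concave (R : realType) (E : lmodType R) (alpha : \bar R)
    (D : set E) (w : E -> R) : Prop :=
  (forall x, D x -> 0 <= w x) /\
  match alpha with
  | (r%:E)%E => 0 < r /\ concave_function D (fun x => w x `^ r)
  | +oo%E => exists c, forall x, D x -> w x = c
  | -oo%E => False
  end.

(* Main.v *)
Require Import Defs.
From mathcomp Require Import all_boot all_order all_algebra.
From mathcomp Require Import all_classical all_reals all_analysis.
From mathcomp Require Import ring lra.
Import Order.TTheory GRing.Theory Num.Theory.
Import numFieldNormedType.Exports.
Local Open Scope classical_set_scope.
Local Open Scope ring_scope.

(* Put r = (1 - q) / 2, w(x, s) = u(x, s^2)^r and sigma = (q - p) / r < 1. The
   equation becomes
     Lap w = w_s / (2 s) - (1/r - 1) |grad w|^2 / w - r (a w^(-1-sigma) + 1/w).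
   At a negative interior minimum of the concavity function
     w(x2, s2) - (1-l) w(x1, s1) - l w(x3, s3),  (x2, s2) = (1-l)(x1, s1) + l(x3, s3),
   the three gradients agree and 0 <= w_s(x2, s2) <= w_s(xi, si). Moving xi by
   w(xi, si) h, the second order condition contradicts the equation, because
   w^2 / s is convex, a w^(1-sigma) is concave (a^(1/sigma) is), and the
   right-hand source is decreasing in w. A minimum with (x1, s1) on the parabolic
   boundary is impossible: w leaves 0 there at a rate h^e with e < 1 (barrier
   from below), while w grows at most linearly near (x2, s2). The latter cannot
   use joint differentiability of u, which is not assumed; it follows by
   comparing u with its parabolic dilation centred at a point of the domain. *)

(** * Second order jets and the comparison principle *)

(** The exponent r is the one with r - 1 + q = -r, which turns the source u^q into 1/w. Multiplied
    by w^2, the transformed equation has the sources a w^(1-sigma) and w, and its gradient term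
    becomes w |grad w|^2 up to a constant: linear in w once the three gradients agree. This is why
    the points are moved in proportion to w. The lower bound on p says sigma < 1, so that a
    w^(1-sigma) is a weighted geometric mean of a^(1/sigma) and w; the threshold on theta is
    1/sigma. Squaring the time produces the coefficient 1/(2 s), hence the convex quotient w^2/s.
    The space derivatives and the time derivative of u exist separately, so differential information
    is carried by jets along coordinate lines and by one time derivative, and every estimate that
    mixes space and time goes through comparison. The rate e is (1-q)/(1-p) at the initial time and
    r on the lateral boundary; the hypothesis p < q makes the first smaller than 1. *)

Section Jets.
Context {R : realType}.
Implicit Types (f g : R -> R) (c d : R).

(** The second derivative is required at 0 only, the first one in a neighbourhood: exactly what a
    second order test at an extremum uses. *)
Definition jet2 (g : R -> R) (d1 d2 : R) : Prop :=
  exists g' : R -> R,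
    [/\ \forall h \near (0 : R), is_derive h (1 : R) g (g' h), g' 0 = d1 &
        is_derive (0 : R) (1 : R) g' d2].

Lemma jet2_near_eq f g d1 d2 :
  (\forall h \near (0 : R), g h = f h) -> jet2 g d1 d2 -> jet2 f d1 d2.
Proof.
move=> fg [g' [Hg g0 dg]]; exists g'; split => //.
have fg2 := near_join fg.
near=> h; apply: (@near_eq_is_derive _ _ _ g); first by near: h.
by near: h.
Unshelve. all: by end_near. Qed.

Lemma jet2_lin c1 c2 f g d1 d2 e1 e2 :
  jet2 f d1 d2 -> jet2 g e1 e2 ->
  jet2 (fun h => c1 * f h + c2 * g h) (c1 * d1 + c2 * e1) (c1 * d2 + c2 * e2).
Proof.
move=> [f' [Hf f0 df]] [g' [Hg g0 dg]].
have lin (u v : R -> R) (x a b : R) : is_derive x (1 : R) u a ->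
    is_derive x (1 : R) v b ->
    is_derive x (1 : R) (fun h => c1 * u h + c2 * v h) (c1 * a + c2 * b).
  by move=> Hu Hv; apply: (@is_deriveD _ _ _ (c1 \*: u) (c2 \*: v)).
exists (fun h => c1 * f' h + c2 * g' h); split; [|by rewrite f0 g0|exact: lin].
by near=> h; apply: lin; near: h.
Unshelve. all: by end_near. Qed.

Lemma jet2_scale c f d1 d2 :
  jet2 f d1 d2 -> jet2 (fun h => f (c * h)) (c * d1) (c ^+ 2 * d2).
Proof.
move=> [f' [Hf f0 df]].
have sc (u : R -> R) (x a : R) : is_derive (c * x) (1 : R) u a ->
    is_derive x (1 : R) (fun h => u (c * h)) (c * a).
  move=> Hu; rewrite mulrC.
  have Hs : is_derive x (1 : R) (fun h : R => c * h) c.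
    rewrite -[X in is_derive _ _ _ X]mulr1.
    exact: (@is_deriveZ _ _ _ id c _ _ _ (is_derive_id _ _)).
  exact: (@is_derive1_comp _ u (fun h => c * h)).
exists (fun h => c * f' (c * h)); split.
- have Hc : (fun h : R => c * h) @ (0 : R) --> (0 : R).
    by rewrite -[X in _ --> X](mulr0 c); exact: mulrl_continuous.
  have Hg : \forall h \near (0 : R), is_derive (c * h) (1 : R) f (f' (c * h)).
    exact: (Hc _ Hf).
  by near=> h; apply: sc; near: h.
- by rewrite mulr0 f0.
- rewrite expr2 -mulrA; apply: (@is_deriveZ _ _ _ (fun h => f' (c * h)) c).
  by apply: sc; rewrite mulr0.
Unshelve. all: by end_near. Qed.

Lemma jet2_continuous f d1 d2 : jet2 f d1 d2 -> {for 0, continuous f}.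
Proof.
move=> [f' [Hf _ _]]; have H0 := nbhs_singleton Hf.
by apply: differentiable_continuous; apply/derivable1_diffP; case: H0.
Qed.

Lemma jet2_powR r f d1 d2 : jet2 f d1 d2 -> 0 < f 0 ->
  jet2 (fun h => f h `^ r) (r * f 0 `^ (r - 1) * d1)
    (r * f 0 `^ (r - 1) * d2 + r * (r - 1) * f 0 `^ (r - 2) * d1 ^+ 2).
Proof.
move=> jf f0_gt0; have cf := jet2_continuous _ _ _ jf.
move: jf => [f' [Hf f0 df]].
have pw (s x a : R) : 0 < f x -> is_derive x (1 : R) f a ->
    is_derive x (1 : R) (fun h => f h `^ s) (s * f x `^ (s - 1) * a).
  move=> fx Hx.
  have Hp := @is_derive1_powR R s (f x) fx.
  have := @is_derive1_comp _ (@powR R ^~ s) f x _ _ Hp Hx.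
  exact.
exists (fun h => r * f h `^ (r - 1) * f' h); split.
- have Hp : \forall h \near (0 : R), 0 < f h.
    exact: (cf _ (lt_nbhsr f0_gt0)).
  by near=> h; apply: pw; near: h.
- by rewrite f0.
- have Hd : is_derive (0 : R) (1 : R) f d1 by rewrite -f0; exact: (nbhs_singleton Hf).
  have H1 := pw (r - 1) 0 d1 f0_gt0 Hd.
  have H2 := @is_deriveZ _ _ _ _ r _ _ _ H1.
  have H3 := @is_deriveM _ _ _ _ _ _ _ _ H2 df.
  apply: is_derive_eq H3 _.
  rewrite /GRing.scale /= f0 -[r - 1 - 1]addrA -opprD -[1+1]/(2%:R).
  rewrite -[r *: f 0 `^ (r - 1)]/(r * f 0 `^ (r - 1)).
  by ring.
Unshelve. all: by end_near. Qed.

(** Only left increments are compared, because the extremum may sit at the final time of the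
    cylinder. *)
Lemma is_derive_ge0_left g (x : R) d : is_derive x (1 : R) g d ->
  (\forall h \near (0 : R)^'-, g (h + x) <= g x) -> 0 <= d.
Proof.
move=> [dg <-] Hle; rewrite ['D_1 g x]cvg_at_leftE //.
apply: limr_ge.
  rewrite -(cvg_at_leftE (fun h => h^-1 *: ((g \o shift x) (h *: 1) - g x))) //.
  apply: cvg_trans dg; apply: cvg_app.
  by move=> A [e egt0 Ae]; exists e => // y ye y0; apply: Ae => //; exact: ltr0_neq0.
near=> h; apply: mulr_le0.
  by rewrite invr_le0; apply: ltW; near: h; exact: nbhs_left_lt.
by rewrite subr_le0 /= [_%:A]mulr1; near: h.
Unshelve. all: by end_near. Qed.

(** If [d2] were positive, [g'] would be positive just to the right of 0, and the mean value theorem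
    would lift [g] above [g 0]. *)
Lemma jet2_max g d1 d2 : jet2 g d1 d2 ->
  (\forall h \near (0 : R), g h <= g 0) -> d1 = 0 /\ d2 <= 0.
Proof.
move=> [g' [Hg <- dg']] Hmax.
have /nbhs_ballP[e /= e0 He] : \forall h \near (0 : R),
    is_derive h (1 : R) g (g' h) /\ g h <= g 0 by near do split.
have He' h : h \in `]-e, e[ -> is_derive h (1 : R) g (g' h) /\ g h <= g 0.
  rewrite in_itv /= => hh; apply: He.
  by rewrite /ball /= sub0r normrN ltr_norml.
have g'0 : g' 0 = 0.
  have H0 : (0 : R) \in `]-e, e[ by rewrite in_itv /= oppr_lt0 e0.
  have Hd : is_derive (0 : R) (1 : R) g 0.
    apply: (@derive1_at_max _ g (- e) e) => //.
    - by rewrite ge0_cp // ltW.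
    - by move=> t /He'[[]].
    - by move=> t /He'[].
  have [[_ <-] _] := He' _ H0; exact: derive_val.
split=> //; rewrite leNgt; apply/negP => d2_gt0.
case: dg' => dg' dE.
have Hq : \forall h \near (0 : R)^', 0 < h^-1 *: (g' (h *: 1 + 0) - g' 0).
  have Hc : h^-1 *: (g' (h *: 1 + 0) - g' 0) @[h --> (0 : R)^'] --> d2.
    by rewrite -dE; exact: dg'.
  exact: (Hc _ (lt_nbhsr d2_gt0)).
have {Hq}[r /= r0 Hr] := Hq.
pose b := Num.min r e / 2.
have m0 : 0 < Num.min r e by rewrite lt_min r0.
have b0 : 0 < b by rewrite divr_gt0.
have bm : b < Num.min r e by rewrite /b ltr_pdivrMr // ltr_pMr // ltr1n.
have [bltr blte] : b < r /\ b < e by move: bm; rewrite lt_min => /andP[].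
have dg x : 0 <= x <= b -> is_derive x (1 : R) g (g' x).
  move=> /andP[x0 xb]; apply: (He' x _).1; rewrite in_itv /=.
  by rewrite (lt_le_trans _ x0) ?oppr_lt0 //= (le_lt_trans xb).
have [c cb Ec] : exists2 c, c \in `]0, b[ & g b - g 0 = g' c * (b - 0).
  apply: MVT => // [x|].
    by rewrite in_itv /= => /andP[x0 xb]; apply: dg; rewrite !ltW.
  apply: derivable_within_continuous => x; rewrite in_itv /= => /dg[].
  by [].
have {}cb : 0 < c < b by move: cb; rewrite in_itv.
case/andP: cb => c0 cb.
have g'c : 0 < g' c.
  have := Hr c; rewrite /ball_ /= sub0r normrN gtr0_norm // (lt_trans cb) //.
  move=> /(_ isT (lt0r_neq0 c0)); rewrite g'0 subr0 addr0.
  by rewrite [c *: 1]mulr1 pmulr_rgt0 // invr_gt0.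
have : g b <= g 0.
  by apply: (He' b _).2; rewrite in_itv /= blte andbT (lt_trans _ b0) ?oppr_lt0.
by rewrite -subr_le0 Ec subr0 leNgt mulr_gt0.
Unshelve. all: by end_near. Qed.

End Jets.

(** * The heat operator on powers, and comparison of sub- and supersolutions *)

Section SpaceTime.
Context {R : realType} {n : nat}.
Implicit Types (x : 'rV[R]_n) (t : R) (v z : 'rV[R]_n -> R -> R).

(** [g] is the gradient and [D] the diagonal of the Hessian, so [\sum_i D i] is the Laplacian. Mixed
    derivatives and joint differentiability are deliberately absent. *)
Definition jet_at v x t (vt : R) (g D : 'I_n -> R) : Prop :=
  is_derive t (1 : R) (v x) vt /\
  forall i, jet2 (fun h => v (h *: delta_mx ord0 i + x) t) (g i) (D i).

Lemma jet_at_powR (r : R) v x t vt g D : jet_at v x t vt g D -> 0 < v x t ->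
  jet_at (fun y s => v y s `^ r) x t (r * v x t `^ (r - 1) * vt)
    (fun i => r * v x t `^ (r - 1) * g i)
    (fun i => r * v x t `^ (r - 1) * D i + r * (r - 1) * v x t `^ (r - 2) * g i ^+ 2).
Proof.
move=> [dv jv] v0; split=> [|i].
  have Hp := @is_derive1_powR R r (v x t) v0.
  have := @is_derive1_comp _ (@powR R ^~ r) (v x) t _ _ Hp dv.
  exact.
have := jet2_powR r _ _ _ (jv i); rewrite /= scale0r add0r; exact.
Qed.

Lemma near_line (Om : set 'rV[R]_n) x (e : 'rV[R]_n) : open Om -> Om x ->
  \forall h \near (0 : R), Om (h *: e + x).
Proof.
move=> oO Ox.
have Hc : (fun h : R => h *: e + x) @ (0 : R) --> x.
  rewrite -[X in _ --> X]add0r -(scale0r e).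
  by apply: cvgD; [apply: cvgZr_tmp; exact: cvg_id|exact: cvg_cst].
by apply: Hc; apply: open_nbhs_nbhs.
Qed.

(** Heat operator of a power, with the quadratic term expressed through the gradient of the power
    itself. Where the gradients of two powers agree, their quadratic terms differ only by the
    denominators [s ^ r]. *)
Lemma jet_at_powR_heat (r : R) (s : R) (g D : 'I_n -> R) (st : R) :
  0 < s -> 0 < r ->
  r * s `^ (r - 1) * st
    - \sum_i (r * s `^ (r - 1) * D i + r * (r - 1) * s `^ (r - 2) * g i ^+ 2)
  = r * s `^ (r - 1) * (st - \sum_i D i)
    + (1 - r) / r * (\sum_i (r * s `^ (r - 1) * g i) ^+ 2) / s `^ r.
Proof.
move=> s0 r0.
have -> (c : R) : \sum_i (c * g i) ^+ 2 = c ^+ 2 * \sum_i g i ^+ 2.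
  by rewrite mulr_sumr; apply: eq_bigr => i _; rewrite exprMn.
rewrite big_split /= -!mulr_sumr.
have -> : s `^ (r - 1) = s `^ (r - 2) * s.
  rewrite -{3}(powRr1 (ltW s0)) -powRD; last by rewrite (gt_eqF s0) implybT.
  by congr (_ `^ _); ring.
have -> : s `^ r = s `^ (r - 2) * s ^+ 2.
  rewrite -(powR_mulrn _ (ltW s0)) -powRD; last by rewrite (gt_eqF s0) implybT.
  by congr (_ `^ _); ring.
have := powR_gt0 (r - 2) s0; move: (s `^ (r - 2)) => P P0.
move: (\sum_i g i ^+ 2) (\sum_i D i) => G E.
by field; rewrite !gt_eqF.
Qed.

Lemma within_continuousP {T U : topologicalType} (K : set T) (f : T -> U) :
  {within K, continuous f} <->
  forall y, K y -> f s @[s --> within K (nbhs y)] --> f y.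
Proof. exact: subspace_continuousP. Qed.

Lemma within_continuous_powR {T : topologicalType} (K : set T) (f : T -> R) (r : R) :
  0 < r -> {within K, continuous f} -> (forall y, K y -> 0 <= f y) ->
  {within K, continuous (fun y => f y `^ r)}.
Proof.
move=> r0 /within_continuousP cf f0; apply/within_continuousP => x Kx.
have := f0 _ Kx; rewrite le_eqVlt => /predU1P[fx|fx].
  (* At a zero of [f] the power need not be differentiable; there the tolerance [e] is pulled back
     to [e ^ (1/r)]. *)
  rewrite -fx powR0 ?gt_eqF //; apply/cvgrPdist_lt => e e0.
  have e1 : 0 < e `^ r^-1 by rewrite powR_gt0.
  have := cf _ Kx; rewrite -fx => /cvgrPdist_lt/(_ _ e1).
  have Kw : \forall y \near within K (nbhs x), K y by exact: withinT.
  move=> H; near=> y; have Ky : K y by near: y.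
  rewrite sub0r normrN ger0_norm ?powR_ge0 //.
  have : `|0 - f y| < e `^ r^-1 by near: y.
  rewrite sub0r normrN ger0_norm ?f0 // => H1.
  have := @gt0_ltr_powR _ r r0 (f y) (e `^ r^-1).
  rewrite !nnegrE f0 // powR_ge0 -powRrM mulVf ?gt_eqF // powRr1 ?ltW //.
  exact.
have Hd : {for f x, continuous (@powR R ^~ r)}.
  apply: differentiable_continuous; apply/derivable1_diffP.
  by have [] := @is_derive1_powR R r (f x) fx.
exact: (cvg_comp _ _ (cf _ Kx) Hd).
Unshelve. all: by end_near. Qed.

(* Comparing the powers v^r and z^r makes the transformed reaction decreasing,
   although s |-> f x s need not be Lipschitz at 0. *)
Lemma comparison (Om : set 'rV[R]_n) (T r : R) (f : 'rV[R]_n -> R -> R) v z :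
  open Om -> compact (closure Om) -> 0 < r < 1 ->
  (forall x (s1 s2 : R), Om x -> 0 < s2 < s1 ->
     s1 `^ (r - 1) * f x s1 < s2 `^ (r - 1) * f x s2) ->
  {within closure Om `*` `[0, T], continuous (fun y : 'rV[R]_n * R => v y.1 y.2)} ->
  {within closure Om `*` `[0, T], continuous (fun y : 'rV[R]_n * R => z y.1 y.2)} ->
  (forall x t, closure Om x -> 0 <= t <= T -> 0 <= v x t) ->
  (forall x t, closure Om x -> 0 <= t <= T -> 0 <= z x t) ->
  (forall x t, closure Om x -> 0 <= t <= T -> z x t < v x t ->
     [/\ Om x, 0 < t, 0 < z x t & exists vt gv Dv zt gz Dz,
       [/\ jet_at v x t vt gv Dv, jet_at z x t zt gz Dz,
           vt - \sum_i Dv i <= f x (v x t) & f x (z x t) <= zt - \sum_i Dz i]]) ->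
  forall x t, closure Om x -> 0 <= t <= T -> v x t <= z x t.
Proof.
move=> oO cO /andP[r0 r1] mf cv cz v0 z0 H x1 t1 Ox1 t1T.
rewrite leNgt; apply/negP => vz1.
pose K : set ('rV[R]_n * R) := closure Om `*` `[0, T]%classic.
have KE (y : 'rV[R]_n) (s : R) : K (y, s) <-> closure Om y /\ 0 <= s <= T.
  by rewrite /K /= in_itv.
pose F (y : 'rV[R]_n * R) : R := v y.1 y.2 `^ r - z y.1 y.2 `^ r.
have cF : {within K, continuous F}.
  have nn (w : 'rV[R]_n -> R -> R) : (forall x t, closure Om x -> 0 <= t <= T -> 0 <= w x t) ->
      forall y, K y -> 0 <= w y.1 y.2.
    by move=> Hw [y s] /KE[]; exact: Hw.
  have /within_continuousP c1 := within_continuous_powR _ _ _ r0 cv (nn _ v0).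
  have /within_continuousP c2 := within_continuous_powR _ _ _ r0 cz (nn _ z0).
  by apply/within_continuousP => y Ky; apply: cvgB; [exact: c1|exact: c2].
have Kx1 : K (x1, t1) by apply/KE.
have [[x0 t0] Kx0 Fmax] : exists2 c, c \in K & forall y, y \in K -> F y <= F c.
  apply: compact_EVT_max cF; first by exists (x1, t1).
  by apply: compact_setX => //; exact: segment_compact.
have {}Fmax y s : closure Om y -> 0 <= s <= T -> F (y, s) <= F (x0, t0).
  by move=> Oy sT; apply: Fmax; rewrite inE; apply/KE.
move: Kx0; rewrite inE => /KE[Ox0 t0T].
(* A positive maximum forces z < v at the maximum point, so the hypothesis supplies jets there, in
   the interior and at a positive time. *)
have vz0 : z x0 t0 < v x0 t0.
  have := Fmax _ _ Ox1 t1T; rewrite /F /= => HF.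
  have h1 : z x1 t1 `^ r < v x1 t1 `^ r.
    by apply: gt0_ltr_powR; rewrite ?nnegrE ?v0 ?z0 //.
  rewrite ltNge; apply/negP => h2.
  have : v x0 t0 `^ r <= z x0 t0 `^ r.
    by apply: ge0_ler_powR; rewrite ?nnegrE ?v0 ?z0 // ltW.
  lra.
have [Oo t00 zp [vt [gv [Dv [zt [gz [Dz [jv jz Hv Hz]]]]]]]] := H _ _ Ox0 t0T vz0.
have vp := lt_trans zp vz0.
have [dV jV] := jet_at_powR r _ _ _ _ _ _ jv vp.
have [dZ jZ] := jet_at_powR r _ _ _ _ _ _ jz zp.
have Hx i := jet2_max _ _ _ (jet2_lin 1 (-1) _ _ _ _ _ _ (jV i) (jZ i)).
have Hnear i : \forall h \near (0 : R),
    F (h *: delta_mx ord0 i + x0, t0) <= F (x0, t0).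
  near=> h; apply: Fmax => //; apply: subset_closure; near: h.
  exact: near_line.
have {}Hx i : r * v x0 t0 `^ (r - 1) * gv i = r * z x0 t0 `^ (r - 1) * gz i /\
    r * v x0 t0 `^ (r - 1) * Dv i + r * (r - 1) * v x0 t0 `^ (r - 2) * gv i ^+ 2
    <= r * z x0 t0 `^ (r - 1) * Dz i + r * (r - 1) * z x0 t0 `^ (r - 2) * gz i ^+ 2.
  have [|e1 e2] := Hx i; last by split; lra.
  near=> h; have : F (h *: delta_mx ord0 i + x0, t0) <= F (x0, t0).
    by near: h; exact: Hnear.
  by rewrite /F /= scale0r add0r !mul1r !mulN1r.
have Ht : 0 <= r * v x0 t0 `^ (r - 1) * vt - r * z x0 t0 `^ (r - 1) * zt.
  apply: (is_derive_ge0_left _ _ _ (is_deriveB dV dZ)).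
  near=> h; apply: (Fmax x0 (h + t0)) => //.
  have h0 : h < 0 by near: h; exact: nbhs_left_lt.
  have ht : - t0 < h by near: h; apply: nbhs_left_gt; rewrite oppr_lt0.
  lra.
have hV := jet_at_powR_heat r _ gv Dv vt vp r0.
have hZ := jet_at_powR_heat r _ gz Dz zt zp r0.
set GV := \sum_i (r * v x0 t0 `^ (r - 1) * gv i) ^+ 2 in hV.
have EG : \sum_i (r * z x0 t0 `^ (r - 1) * gz i) ^+ 2 = GV.
  by apply: eq_bigr => i _; rewrite (Hx i).1.
rewrite EG in hZ.
have GV0 : 0 <= GV by apply: sumr_ge0 => i _; exact: sqr_ge0.
have hD := @ler_sum _ _ (index_enum 'I_n) xpredT _ _ (fun i _ => (Hx i).2).
have vr : z x0 t0 `^ r < v x0 t0 `^ r.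
  by apply: gt0_ltr_powR; rewrite ?nnegrE ?ltW //.
have zr : 0 < z x0 t0 `^ r by exact: powR_gt0.
have kr : 0 <= (1 - r) / r by rewrite divr_ge0 ?subr_ge0 ?ltW.
(* Here r < 1 is used: the common quadratic term is divided by the larger power on the side of the
   subsolution, which is the favourable sign. *)
have hG : (1 - r) / r * GV / v x0 t0 `^ r <= (1 - r) / r * GV / z x0 t0 `^ r.
  apply: ler_wpM2l; first exact: mulr_ge0.
  by rewrite lef_pV2 ?posrE ?(lt_trans zr vr) //; exact: ltW.
have h1 : r * v x0 t0 `^ (r - 1) * (vt - \sum_i Dv i)
    <= r * (v x0 t0 `^ (r - 1) * f x0 (v x0 t0)).
  by rewrite -mulrA ler_wpM2l ?(ltW r0) // ler_wpM2l ?powR_ge0.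
have h2 : r * (z x0 t0 `^ (r - 1) * f x0 (z x0 t0)) <=
    r * z x0 t0 `^ (r - 1) * (zt - \sum_i Dz i).
  by rewrite -mulrA ler_wpM2l ?(ltW r0) // ler_wpM2l ?powR_ge0.
have h3 : r * (v x0 t0 `^ (r - 1) * f x0 (v x0 t0)) <
    r * (z x0 t0 `^ (r - 1) * f x0 (z x0 t0)).
  by rewrite ltr_pM2l // mf // zp.
lra.
Unshelve. all: by end_near. Qed.

End SpaceTime.

(** * Affine changes of the space and time variables *)

Section Affine.
Context {R : realType} {n : nat}.

Lemma within_comp_continuous {T U V : topologicalType} (L : set T) (K : set U)
    (g : T -> U) (f : U -> V) :
  {within K, continuous f} -> continuous g -> (forall y, L y -> K (g y)) ->
  {within L, continuous (fun y => f (g y))}.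
Proof.
move=> /within_continuousP cf cg LK; apply/within_continuousP => y Ly.
apply: (@cvg_comp _ _ _ g f _ (within K (nbhs (g y))) _ _ (cf _ (LK _ Ly))) => A HA.
have H : nbhs y (fun w => K (g w) -> A (g w)) := cg y _ HA.
change (nbhs y (fun w => L w -> A (g w))).
by apply: filterS H => w Hw /LK.
Qed.

Lemma is_derive_affine (g : R -> R) (c b t d : R) :
  is_derive (c * t + b) (1 : R) g d ->
  is_derive t (1 : R) (fun s => g (c * s + b)) (c * d).
Proof.
move=> Hg; rewrite mulrC.
have Ha : is_derive t (1 : R) (fun s : R => c * s + b) c.
  rewrite -[X in is_derive _ _ _ X]addr0 -{2}[c]mulr1.
  have Hc := @is_deriveZ _ _ _ id c t 1 1 (is_derive_id _ _).
  exact: (@is_deriveD _ _ _ _ _ _ _ _ _ Hc (is_derive_cst b t 1)).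
exact: (@is_derive1_comp _ g (fun s : R => c * s + b)).
Qed.

(** Serves both competitors built from u: the time translate ([M = c = c2 = 1]) and the parabolic
    dilation ([c2 = c ^+ 2]). *)
Lemma jet_at_affine (v : 'rV[R]_n -> R -> R) (M c c2 b2 : R) (b x : 'rV[R]_n) t
    vt g D :
  jet_at v (c *: x + b) (c2 * t + b2) vt g D ->
  jet_at (fun y s => M * v (c *: y + b) (c2 * s + b2)) x t (M * (c2 * vt))
    (fun i => M * (c * g i)) (fun i => M * (c ^+ 2 * D i)).
Proof.
move=> [dv jv]; split=> [|i].
  exact: (@is_deriveZ _ _ _ _ M _ _ _ (is_derive_affine _ _ _ _ _ dv)).
have := jet2_scale c _ _ _ (jv i) => Hs.
have := jet2_lin M 0 _ _ _ _ _ _ Hs Hs; rewrite !mul0r !addr0.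
apply: jet2_near_eq; near=> h.
by rewrite mul0r addr0 scalerDr scalerA addrA.
Unshelve. all: by end_near. Qed.

Lemma affine_pair_continuous (c d : R) (b : 'rV[R]_n) (e : R) :
  continuous (fun y : 'rV[R]_n * R => (c *: y.1 + b, d * y.2 + e)).
Proof.
move=> y.
have H1 : (c *: x.1 + b) @[x --> y] --> c *: y.1 + b.
  by apply: cvgD; [apply: cvgZl_tmp; exact: cvg_fst|exact: cvg_cst].
have H2 : (d * x.2 + e) @[x --> y] --> d * y.2 + e.
  apply: cvgD; last exact: cvg_cst.
  by apply: cvgM; [exact: cvg_cst|exact: cvg_snd].
exact: (cvg_pair H1 H2).
Qed.

End Affine.

Lemma gt0_gtr_powR {R : realType} (e s1 s2 : R) : e < 0 -> 0 < s2 < s1 ->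
  s1 `^ e < s2 `^ e.
Proof.
move=> e0 /andP[s20 s21]; have s10 := lt_trans s20 s21.
rewrite -[e]opprK !(powRN _ (- e)) ltf_pV2 ?posrE ?powR_gt0 //.
by apply: gt0_ltr_powR; rewrite ?oppr_gt0 ?nnegrE ?ltW.
Qed.

Lemma convex_combination_continuous {R : realType} {n : nat} (c d : R) :
  continuous (fun z : ('rV[R]_n * R) * ('rV[R]_n * R) =>
    (c *: z.1.1 + d *: z.2.1, c * z.1.2 + d * z.2.2)).
Proof.
move=> z; set F := nbhs z.
have f11 : (fun z : ('rV[R]_n * R) * ('rV[R]_n * R) => z.1.1) @ F --> z.1.1.
  exact: (cvg_comp _ _ cvg_fst cvg_fst).
have f12 : (fun z : ('rV[R]_n * R) * ('rV[R]_n * R) => z.1.2) @ F --> z.1.2.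
  exact: (cvg_comp _ _ cvg_fst cvg_snd).
have f21 : (fun z : ('rV[R]_n * R) * ('rV[R]_n * R) => z.2.1) @ F --> z.2.1.
  exact: (cvg_comp _ _ cvg_snd cvg_fst).
have f22 : (fun z : ('rV[R]_n * R) * ('rV[R]_n * R) => z.2.2) @ F --> z.2.2.
  exact: (cvg_comp _ _ cvg_snd cvg_snd).
have m1 : (fun z : ('rV[R]_n * R) * ('rV[R]_n * R) => c *: z.1.1 + d *: z.2.1) @ F
    --> c *: z.1.1 + d *: z.2.1.
  by apply: (@cvgD _ _ _ F); apply: (@cvgZl_tmp _ _ _ F).
have m2 : (fun z : ('rV[R]_n * R) * ('rV[R]_n * R) => c * z.1.2 + d * z.2.2) @ F
    --> c * z.1.2 + d * z.2.2.
  by apply: (@cvgD _ _ _ F); apply: (@cvgM _ _ F) => //; exact: cvg_cst.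
exact: (cvg_pair m1 m2).
Qed.

(** * Bump functions supported in Euclidean balls *)

Section Bump.
Context {R : realType} {n : nat}.
Implicit Types (x y : 'rV[R]_n) (d : R).

Definition sqdist y x : R := \sum_(j < n) (x - y) ord0 j ^+ 2.

Lemma sqdist_ge0 y x : 0 <= sqdist y x.
Proof. by apply: sumr_ge0 => j _; exact: sqr_ge0. Qed.

Lemma eball_sqdist y x (d : R) : 0 < d -> eball y d x <-> sqdist y x < d ^+ 2.
Proof.
move=> d0; rewrite /eball /enorm /= -{1}(gtr0_norm d0) -sqrtr_sqr.
by rewrite ltr_sqrt // exprn_gt0.
Qed.

Lemma sqdist_line y x i (h : R) :
  sqdist y (h *: delta_mx ord0 i + x)
    = sqdist y x + 2 * h * (x - y) ord0 i + h ^+ 2.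
Proof.
rewrite /sqdist (bigD1 i) //= [in RHS](bigD1 i) //=.
rewrite (eq_bigr (fun j => (x - y) ord0 j ^+ 2)) => [|j ji]; last first.
  by rewrite !mxE (negbTE ji) andbF mulr0 add0r.
by rewrite !mxE !eqxx /= mulr1; ring.
Qed.

Lemma sqdist_continuous y : continuous (sqdist y).
Proof.
rewrite /sqdist; move: (index_enum _) => s.
elim: s => [|j s IHs] x.
  by under eq_fun do rewrite big_nil; exact: cst_continuous.
under eq_fun do rewrite big_cons; rewrite /continuous_at.
apply: (@cvgD _ _ _ (nbhs x)); last exact: IHs.
have Hj : (fun z : 'rV[R]_n => (z - y) ord0 j) @ x --> (x - y) ord0 j.
  rewrite !mxE; under eq_fun do rewrite !mxE.
  apply: (@cvgB _ _ _ (nbhs x)); last exact: cvg_cst.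
  exact: coord_continuous.
exact: (@cvgM _ _ (nbhs x) _ _ _ _ _ Hj Hj).
Qed.

Definition cap y d x : R := Num.max 0 (1 - sqdist y x / d ^+ 2).

(* The quadratic term makes the bump subharmonic near the boundary of its
   support while it still vanishes only linearly there *)
Definition bell y d x : R := cap y d x + n%:R * cap y d x ^+ 2.

Lemma bell_continuous y d : continuous (bell y d).
Proof.
move=> x.
have Hq : (fun z : 'rV[R]_n => 1 - sqdist y z / d ^+ 2) @ x
    --> 1 - sqdist y x / d ^+ 2.
  apply: (@cvgB _ _ _ (nbhs x)); first exact: cvg_cst.
  by apply: (@cvgM _ _ (nbhs x)); [exact: sqdist_continuous|exact: cvg_cst].
have Hc : cap y d @ x --> cap y d x.
  rewrite /cap maxr_absE; under eq_fun do rewrite maxr_absE.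
  apply: (@cvgM _ _ (nbhs x)); last exact: cvg_cst.
  apply: (@cvgD _ _ _ (nbhs x)).
    by apply: (@cvgD _ _ _ (nbhs x)); [exact: cvg_cst|exact: Hq].
  apply: (@cvg_norm _ _ _ (nbhs x)).
  by apply: (@cvgB _ _ _ (nbhs x)); [exact: cvg_cst|exact: Hq].
apply: (@cvgD _ _ _ (nbhs x)) => //.
by apply: (@cvgM _ _ (nbhs x)); [exact: cvg_cst|exact: (@cvgM _ _ (nbhs x))].
Qed.

Lemma jet2M (f g : R -> R) d1 d2 e1 e2 : jet2 f d1 d2 -> jet2 g e1 e2 ->
  jet2 (fun h => f h * g h) (d1 * g 0 + f 0 * e1)
    (d2 * g 0 + 2 * d1 * e1 + f 0 * e2).
Proof.
move=> [f' [Hf <- df]] [g' [Hg <- dg]].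
have H0f := nbhs_singleton Hf; have H0g := nbhs_singleton Hg.
exists (fun h => f' h * g h + f h * g' h); split => //.
  near=> h.
  have fh : is_derive h (1 : R) f (f' h) by near: h.
  have gh : is_derive h (1 : R) g (g' h) by near: h.
  apply: is_derive_eq (is_deriveM fh gh) _.
  by rewrite addrC [g h *: _]mulrC.
apply: is_derive_eq (is_deriveD (is_deriveM df H0g) (is_deriveM H0f dg)) _.
rewrite -![_ *: _]/(_ * _).
by ring.
Unshelve. all: by end_near. Qed.

Lemma jet2_quadratic (A B C : R) :
  jet2 (fun h => A + B * h + C * h ^+ 2) B (2 * C).
Proof.
have j0 : jet2 (fun=> A) 0 0.
  by exists (fun=> 0); split => //; [near=> h|]; exact: is_derive_cst.
have j1 : jet2 (fun h : R => h) 1 0.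
  by exists (fun=> 1); split => //; [near=> h; exact: is_derive_id|exact: is_derive_cst].
have := jet2_lin 1 C _ _ _ _ _ _ (jet2_lin 1 B _ _ _ _ _ _ j0 j1) (jet2M _ _ _ _ _ _ j1 j1).
have -> : 1 * (1 * 0 + B * 1) + C * (1 * 0 + 0 * 1) = B by ring.
have -> : 1 * (1 * 0 + B * 0) + C * (0 * 0 + 2 * 1 * 1 + 0 * 0) = 2 * C by ring.
by apply: jet2_near_eq; near=> h; ring.
Unshelve. all: by end_near. Qed.

(** Where the cap is positive, the bell restricted to a coordinate line is [Q + n Q^2] near 0 with
    [Q] quadratic. Nothing is claimed at the edge of the support, where the bell has a corner. *)
Lemma jet2_bell y d x i (M : R) : 0 < d -> 0 < cap y d x ->
  jet2 (fun h => M * bell y d (h *: delta_mx ord0 i + x))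
    (M * (- 2 * (x - y) ord0 i / d ^+ 2 * (1 + 2 * n%:R * cap y d x)))
    (M * (- 2 / d ^+ 2 * (1 + 2 * n%:R * cap y d x)
          + 2 * n%:R * (2 * (x - y) ord0 i / d ^+ 2) ^+ 2)).
Proof.
move=> d0; rewrite /cap lt_max ltxx /= => E0.
rewrite (max_idPr (ltW E0)); set E := 1 - _ in E0 *.
set w := (x - y) ord0 i.
pose Q (h : R) := E + (- 2 * w / d ^+ 2) * h + (- d ^- 2) * h ^+ 2.
have QE h : Q h = 1 - sqdist y (h *: delta_mx ord0 i + x) / d ^+ 2.
  by rewrite sqdist_line /Q /E -/w; field; rewrite gt_eqF.
have Q0 : Q 0 = E by rewrite /Q expr0n /= !mulr0 !addr0.
have jQ : jet2 Q (- 2 * w / d ^+ 2) (2 * (- d ^- 2)) by exact: jet2_quadratic.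
have Hc := jet2_continuous _ _ _ jQ.
have := jet2_lin M (M * n%:R) _ _ _ _ _ _ jQ (jet2M _ _ _ _ _ _ jQ jQ).
rewrite Q0.
set A1 := (X in jet2 _ X _); set A2 := (X in jet2 _ _ X).
set B1 := (X in _ -> jet2 _ X _); set B2 := (X in _ -> jet2 _ _ X).
have -> : A1 = B1 by rewrite /A1 /B1; ring.
have -> : A2 = B2 by rewrite /A2 /B2; ring.
apply: jet2_near_eq.
have H : \forall h \near (0 : R), 0 < Q h.
  by apply: (Hc _ (lt_nbhsr _)); rewrite Q0.
near=> h.
have Qh : 0 < Q h by near: h.
by rewrite /bell /cap -QE (max_idPr (ltW Qh)); ring.
Unshelve. all: by end_near. Qed.

End Bump.

(** * Convexity inequalities for means *)

Section MeanInequalities.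
Context {R : realType}.
Implicit Types (s l x y : R).

Lemma weighted_amgm s x y : 0 < s < 1 -> 0 <= x -> 0 <= y ->
  x `^ s * y `^ (1 - s) <= s * x + (1 - s) * y.
Proof.
move=> /andP[s0 s1] x0 y0; have s10 : 0 < 1 - s by rewrite subr_gt0.
have := @conjugate_powR _ (x `^ s) (y `^ (1 - s)) s^-1 (1 - s)^-1
  (powR_ge0 _ _) (powR_ge0 _ _).
rewrite !invr_gt0 !invrK => /(_ s0 s10); rewrite addrC subrK => /(_ erefl).
by rewrite -!powRrM !mulfV ?gt_eqF // !powRr1 // [x * _]mulrC [y * _]mulrC.
Qed.

(** After division by the means [X] and [Y], the weighted arithmetic-geometric inequality applies to
    each term, and the weighted averages of [x / X] and [y / Y] are both 1. *)
Lemma geometric_mean_concave s l x1 y1 x3 y3 : 0 < s < 1 -> 0 < l < 1 ->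
  0 < x1 -> 0 < y1 -> 0 < x3 -> 0 < y3 ->
  (1 - l) * (x1 `^ s * y1 `^ (1 - s)) + l * (x3 `^ s * y3 `^ (1 - s))
    <= ((1 - l) * x1 + l * x3) `^ s * ((1 - l) * y1 + l * y3) `^ (1 - s).
Proof.
move=> /[dup] s01 /andP[s0 s1] /andP[l0 l1] x10 y10 x30 y30.
have l10 : 0 < 1 - l by rewrite subr_gt0.
set X := _ + l * x3; set Y := _ + l * y3.
have X0 : 0 < X by rewrite addr_gt0 // mulr_gt0.
have Y0 : 0 < Y by rewrite addr_gt0 // mulr_gt0.
have H x y : 0 < x -> 0 < y -> x `^ s * y `^ (1 - s)
    <= (X `^ s * Y `^ (1 - s)) * (s * (x / X) + (1 - s) * (y / Y)).
  move=> x0 y0.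
  have xE : x `^ s = X `^ s * (x / X) `^ s.
    by rewrite -powRM ?divr_ge0 ?ltW // mulrC divfK // gt_eqF.
  have yE : y `^ (1 - s) = Y `^ (1 - s) * (y / Y) `^ (1 - s).
    by rewrite -powRM ?divr_ge0 ?ltW // mulrC divfK // gt_eqF.
  rewrite xE yE mulrACA ler_wpM2l ?mulr_ge0 ?powR_ge0 //.
  by apply: weighted_amgm; rewrite ?divr_ge0 ?ltW.
have h1 := ler_wpM2l (ltW l10) (H _ _ x10 y10).
have h3 := ler_wpM2l (ltW l0) (H _ _ x30 y30).
apply: le_trans (lerD h1 h3) _; rewrite le_eqVlt; apply/orP; left; apply/eqP.
set P := X `^ s * _.
have -> : (1 - l) * (P * (s * (x1 / X) + (1 - s) * (y1 / Y)))
    + l * (P * (s * (x3 / X) + (1 - s) * (y3 / Y)))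
  = P * (s * (((1 - l) * x1 + l * x3) / X)
         + (1 - s) * (((1 - l) * y1 + l * y3) / Y)) by ring.
by rewrite -/X -/Y !mulfV ?gt_eqF //; ring.
Qed.

(** The defect is a perfect square, [(x1 y3 - x3 y1)^2], times a positive factor. *)
Lemma square_over_linear_convex l x1 y1 x3 y3 : 0 < l < 1 -> 0 < y1 -> 0 < y3 ->
  ((1 - l) * x1 + l * x3) ^+ 2 / ((1 - l) * y1 + l * y3)
    <= (1 - l) * (x1 ^+ 2 / y1) + l * (x3 ^+ 2 / y3).
Proof.
move=> /andP[l0 l1] y10 y30; have l10 : 0 < 1 - l by rewrite subr_gt0.
have Y0 : 0 < (1 - l) * y1 + l * y3 by rewrite addr_gt0 // mulr_gt0.
rewrite -subr_ge0.
have -> : (1 - l) * (x1 ^+ 2 / y1) + l * (x3 ^+ 2 / y3)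
    - ((1 - l) * x1 + l * x3) ^+ 2 / ((1 - l) * y1 + l * y3)
  = l * (1 - l) * (x1 * y3 - x3 * y1) ^+ 2 / (y1 * y3 * ((1 - l) * y1 + l * y3)).
  by field; rewrite !gt_eqF.
apply: divr_ge0.
  by apply: mulr_ge0; [apply: mulr_ge0; exact: ltW|exact: sqr_ge0].
by rewrite !mulr_ge0 ?ltW.
Qed.

Lemma sub_le_swap (a b c a' b' c' : R) : a - b - c <= a' - b' - c' ->
  b' + c' - a' <= b + c - a.
Proof. lra. Qed.

Lemma sub_le_swapl (a b c a' b' : R) : a - b - c <= a' - b' - c ->
  b' - a' <= b - a.
Proof. lra. Qed.

Lemma sub_le_swapr (a b c a' c' : R) : a - b - c <= a' - b - c' ->
  c' - a' <= c - a.
Proof. lra. Qed.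

(** Final contradiction at an interior minimum: [t1], [t3], [tw] stand for the weighted time
    derivatives, [p1], [p3], [pw] for the terms a w^(1-sigma), and [d] for the weighted Laplacian at
    the mean point. The terms linear in [w1] and [w3] cancel on averaging. *)
Lemma averaged_balance_absurd (k c l w1 w3 p1 p3 pw t1 t3 tw d : R) :
  (1 - l) * (t1 - (c * (p1 + w1) + k * w1)) + l * (t3 - (c * (p3 + w3) + k * w3)) <= d ->
  d < tw - (c * (pw + ((1 - l) * w1 + l * w3)) + k * ((1 - l) * w1 + l * w3)) ->
  tw <= (1 - l) * t1 + l * t3 ->
  c * ((1 - l) * p1 + l * p3) <= c * pw -> False.
Proof. lra. Qed.

End MeanInequalities.

(** * The parabolic problem *)

Section Problem.
Context {R : realType} {n : nat} (Om : set 'rV[R]_n) (p q m : R)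
  (a : 'rV[R]_n -> R) (u : 'rV[R]_n -> R -> R).
Local Notation r := ((1 - q) / 2).
Local Notation sg := ((q - p) / r).
Local Notation f := (fun x (s : R) => a x * s `^ p + s `^ q).
Context (oO : open Om) (cO : compact (closure Om))
  (vO : forall (x y : 'rV[R]_n) (l : R), Om x -> Om y -> 0 <= l <= 1 ->
     Om ((1 - l) *: x + l *: y))
  (q1 : q < 1) (p0 : 0 < p) (pq : p < q) (sg1 : q - p < r)
  (u_jet : forall (x : 'rV[R]_n) (t : R), Om x -> 0 < t -> exists ut g D,
     jet_at u x t ut g D /\ ut - \sum_i D i = f x (u x t))
  (u_cont : {within closure Om `*` `[0, +oo[,
     continuous (fun z : 'rV[R]_n * R => u z.1 z.2)})
  (u_pos : forall (x : 'rV[R]_n) (t : R), Om x -> 0 < t -> 0 < u x t)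
  (u_lat : forall (x : 'rV[R]_n) (t : R), closure Om x -> ~ Om x -> 0 <= t -> u x t = 0)
  (u_ini : forall x : 'rV[R]_n, closure Om x -> u x 0 = 0)
  (O_sphere : forall x : 'rV[R]_n, closure Om x -> ~ Om x -> exists y d,
     [/\ Om y, 0 < d, eball y d `<=` Om & sqdist y x <= d ^+ 2])
  (m0 : 0 < m) (am : forall x : 'rV[R]_n, Om x -> m <= a x)
  (a_conc : forall (x y : 'rV[R]_n) (l : R), Om x -> Om y -> 0 <= l <= 1 ->
     (1 - l) * a x `^ sg^-1 + l * a y `^ sg^-1
       <= a ((1 - l) *: x + l *: y) `^ sg^-1).

(** * Sign, reaction term and monotonicity in time *)

Lemma r_gt0 : 0 < r. Proof. by rewrite divr_gt0 ?subr_gt0. Qed.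

Lemma r_lt1 : r < 1. Proof. by move: p0 pq => ? ?; lra. Qed.

Lemma u_ge0 (x : 'rV[R]_n) (t : R) : closure Om x -> 0 <= t -> 0 <= u x t.
Proof.
move=> cx; rewrite le_eqVlt => /predU1P[<-|t0]; first by rewrite u_ini.
have [Ox|nOx] := pselect (Om x); first exact/ltW/u_pos.
by rewrite u_lat // ltW.
Qed.

Lemma u_gt0 (x : 'rV[R]_n) (t : R) : closure Om x -> 0 <= t -> 0 < u x t -> Om x /\ 0 < t.
Proof.
move=> cx; rewrite le_eqVlt => /predU1P[<-|t0]; first by rewrite u_ini ?ltxx.
have [Ox //|nOx] := pselect (Om x).
by rewrite u_lat ?ltxx // ltW.
Qed.

(** The two exponents that appear, [r - 1 + p] and [r - 1 + q = - r], are negative. *)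
Lemma reaction_decr (x : 'rV[R]_n) (s1 s2 : R) : Om x -> 0 < s2 < s1 ->
  s1 `^ (r - 1) * f x s1 < s2 `^ (r - 1) * f x s2.
Proof.
move=> Ox /[dup] s12 /andP[s20 s21]; have s10 := lt_trans s20 s21.
have E (s : R) : 0 < s ->
    s `^ (r - 1) * f x s = a x * s `^ (r - 1 + p) + s `^ (r - 1 + q).
  move=> s0; rewrite !powRD; try by rewrite (gt_eqF s0) implybT.
  by ring.
rewrite !E //; apply: ltr_leD.
  rewrite ltr_pM2l ?(lt_le_trans m0 (am _ Ox)) //.
  by apply: gt0_gtr_powR => //; move: q1 pq => ? ?; lra.
by apply/ltW/gt0_gtr_powR => //; move: q1 => ?; lra.
Qed.

Lemma u_continuous_comp (M : R) (L : set ('rV[R]_n * R))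
    (g : 'rV[R]_n * R -> 'rV[R]_n * R) : continuous g ->
  (forall y, L y -> closure Om (g y).1 /\ 0 <= (g y).2) ->
  {within L, continuous (fun y => M * u (g y).1 (g y).2)}.
Proof.
move=> cg Lg.
have H : {within L, continuous (fun y => u (g y).1 (g y).2)}.
  apply: (within_comp_continuous _ _ _ _ u_cont cg) => y /Lg[].
  by rewrite /= in_itv /= andbT.
move/within_continuousP in H; apply/within_continuousP => y Ly.
by apply: cvgM; [exact: cvg_cst|exact: H].
Qed.

Lemma u_continuous (T : R) : {within closure Om `*` `[0, T],
  continuous (fun y : 'rV[R]_n * R => u y.1 y.2)}.
Proof.
apply: (within_comp_continuous _ _ id _ u_cont); first by move=> y; exact: cvg_id.
by move=> [y s] [/= cy]; rewrite !in_itv /= => /andP[-> _].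
Qed.

(** The time translate of u by [h] solves the same equation, since a does not depend on time, and
    starts from nonnegative values instead of 0. *)
Lemma u_nondecreasing (x : 'rV[R]_n) (t h : R) : closure Om x -> 0 <= t -> 0 <= h ->
  u x t <= u x (t + h).
Proof.
move=> cx t0 h0.
pose z (y : 'rV[R]_n) (s : R) := 1 * u (1 *: y + 0) (1 * s + h).
have zE y s : z y s = u y (s + h) by rewrite /z !mul1r scale1r addr0.
rewrite -zE; apply: (comparison Om t r f) => //.
- by rewrite r_gt0 r_lt1.
- exact: reaction_decr.
- exact: u_continuous.
- apply: (u_continuous_comp 1 _ (fun y => (1 *: y.1 + 0, 1 * y.2 + h))).
    exact: affine_pair_continuous.
  move=> [y s] [/= cy]; rewrite in_itv /= scale1r addr0 mul1r => /andP[s0 _].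
  by split; rewrite ?addr_ge0.
- by move=> y s cy /andP[s0 _]; exact: u_ge0.
- by move=> y s cy /andP[s0 _]; rewrite zE u_ge0 ?addr_ge0.
- move=> y s cy /andP[s0 _]; rewrite zE => zu.
  have /u_gt0[//|//|Oy {}s0] : 0 < u y s.
    by rewrite (le_lt_trans _ zu) // u_ge0 ?addr_ge0.
  have sh : 0 < s + h by rewrite ltr_wpDr.
  split => //; first exact: u_pos.
  have [ut [g [D [ju eu]]]] := u_jet _ _ Oy s0.
  have [zt [g' [D' [jz ez]]]] := u_jet _ _ Oy sh.
  exists ut, g, D, (1 * (1 * zt)), (fun i => 1 * (1 * g' i)),
    (fun i => 1 * (1 ^+ 2 * D' i)); split => //.
  + by apply: jet_at_affine; rewrite scale1r addr0 mul1r.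
  + by rewrite eu.
  + by under eq_bigr do rewrite expr1n !mul1r; rewrite !mul1r ez.
- by rewrite t0 lexx.
Qed.

(** * The barrier from below *)

Local Notation k := ((1 - p)^-1).

(** [k] is the growth exponent from rest of the equation y' = m y^p: since k p = k - 1, both sides
    carry the factor t^(k-1). What remains is z <= (1 + n) z^p, valid for 0 < z <= 1 + n, and the
    condition on [eps] absorbs the constants. Here [E] is the value of the cap and [S] the squared
    distance to the centre. *)
Lemma barrier_subsolution (c eps E S d t : R) : 0 < d -> 0 <= E <= 1 -> 0 < t ->
  t <= c * d ^+ 2 ->
  S / d ^+ 2 = 1 - E -> 0 < eps -> 0 < E ->
  eps `^ (1 - p) * ((1 + n%:R) * (k + c * (4 * n%:R ^+ 2 + 8 * n%:R))) = m ->
  eps * (k * t `^ (k - 1)) * (E + n%:R * E ^+ 2)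
   - eps * t `^ k * (- 2 / d ^+ 2 * n%:R * (1 + 2 * n%:R * E)
                     + 8 * n%:R * S / d ^+ 4)
  <= m * (eps * t `^ k * (E + n%:R * E ^+ 2)) `^ p.
Proof.
move=> d0 /andP[E0' E1] t0 tc SE eps0 E0 epsE; set z := E + _ in |- *.
have n0 : 0 <= n%:R :> R by [].
have k1 : k * p = k - 1.
  by field; rewrite subr_eq0 gt_eqF // (lt_trans pq q1).
have kk : 1 < k by rewrite invf_gt1 ?subr_gt0 ?(lt_trans pq q1) // ltrBlDr ltrDl.
have z0 : 0 < z by rewrite /z ltr_wpDr // mulr_ge0 // sqr_ge0.
have Ez : E <= z by rewrite /z lerDl mulr_ge0 // sqr_ge0.
have zn : z <= 1 + n%:R.
  by rewrite /z lerD // ler_piMr // exprn_ile1.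
have tk : t `^ k = t * t `^ (k - 1).
  by rewrite mulr_powRB1 ?(ltW t0) // (lt_trans _ kk).
have -> : (eps * t `^ k * z) `^ p = eps `^ p * t `^ (k - 1) * z `^ p.
  rewrite !powRM ?mulr_ge0 ?powR_ge0 ?(ltW eps0) ?(ltW z0) //.
  by rewrite -powRrM k1.
have -> : - 2 / d ^+ 2 * n%:R * (1 + 2 * n%:R * E) + 8 * n%:R * S / d ^+ 4
   = d ^- 2 * (6 * n%:R - (4 * n%:R ^+ 2 + 8 * n%:R) * E).
  have -> : 8 * n%:R * S / d ^+ 4 = 8 * n%:R * (S / d ^+ 2) / d ^+ 2.
    by field; rewrite gt_eqF.
  by rewrite SE; field; rewrite gt_eqF.
set K := 4 * n%:R ^+ 2 + 8 * n%:R in epsE *.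
have K0 : 0 <= K by rewrite addr_ge0 ?mulr_ge0 // sqr_ge0.
set B := t `^ (k - 1) in tk *.
have B0 : 0 < B by exact: powR_gt0.
have td : t * d ^- 2 <= c by rewrite -ler_pdivlMr ?invr_gt0 ?exprn_gt0 // invrK.
(* The positive part [6 n] of the Laplacian has the good sign and is dropped; the rest is controlled
   by E <= z and t / d^2 <= c. *)
have h1 : eps * (k * B) * z - eps * t `^ k * (d ^- 2 * (6 * n%:R - K * E))
    <= eps * B * (z * (k + c * K)).
  rewrite tk; set D := d ^- 2 in td *.
  have -> : eps * (k * B) * z - eps * (t * B) * (D * (6 * n%:R - K * E))
     = eps * B * (z * k + t * D * (K * E - 6 * n%:R)) by ring.
  rewrite ler_wpM2l ?mulr_ge0 ?(ltW eps0) ?(ltW B0) // [z * (_ + _)]mulrDr lerD2l.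
  have D0 : 0 <= t * D by rewrite mulr_ge0 ?(ltW t0) // invr_ge0 exprn_ge0 // ltW.
  apply: (@le_trans _ _ (t * D * (K * z))).
    by rewrite ler_wpM2l // lerBlDr ler_wpDr ?mulr_ge0 // ler_wpM2l.
  by rewrite mulrA [z * _]mulrC ler_wpM2r ?(ltW z0) // ler_wpM2r.
apply: le_trans h1 _.
have hz : z <= (1 + n%:R) * z `^ p.
  have p1 : p < 1 := lt_trans pq q1.
  have zE : z = z `^ (1 - p) * z `^ p.
    rewrite -powRD ?subrK ?powRr1 ?ltW //.
    by rewrite (gt_eqF z0) implybT.
  rewrite {1}zE ler_wpM2r ?powR_ge0 //.
  apply: (@le_trans _ _ ((1 + n%:R) `^ (1 - p))).
    by apply: ge0_ler_powR; rewrite ?nnegrE ?subr_ge0 ?(ltW p1) ?(ltW z0) // addr_ge0.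
  by apply: ler1_powR; rewrite ?lerDl // gerBl ltW.
have hk : 0 <= k + c * K.
  rewrite addr_ge0 ?mulr_ge0 //; first by rewrite (le_trans _ (ltW kk)).
  by apply: le_trans td; rewrite mulr_ge0 ?(ltW t0) // invr_ge0 exprn_ge0 // ltW.
have epsE2 : eps = eps `^ (1 - p) * eps `^ p.
  rewrite -powRD ?subrK ?powRr1 ?(ltW eps0) //.
  by rewrite (gt_eqF eps0) implybT.
rewrite -epsE {1}epsE2.
apply: (@le_trans _ _ (eps `^ (1 - p) * eps `^ p * B * ((1 + n%:R) * z `^ p * (k + c * K)))).
  rewrite ler_wpM2l ?mulr_ge0 ?powR_ge0 ?(ltW B0) // ler_wpM2r //.
by rewrite le_eqVlt; apply/orP; left; apply/eqP; ring.
Qed.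

(** The constant depends on the ball and the time span only through the bound [c] on [T / d ^+ 2].
    This parabolic scale invariance allows balls and times that shrink together. *)
Lemma barrier (y x : 'rV[R]_n) (d T c t : R) : 0 < d -> eball y d `<=` Om ->
  T <= c * d ^+ 2 -> 0 < c -> closure Om x -> 0 <= t <= T ->
  (m / ((1 + n%:R) * (k + c * (4 * n%:R ^+ 2 + 8 * n%:R)))) `^ k * t `^ k
    * bell y d x <= u x t.
Proof.
move=> d0 dO Tc c0 cx tT.
set N := (1 + n%:R) * _; set eps := _ `^ k.
have p1 : 0 < 1 - p by rewrite subr_gt0 (lt_trans pq q1).
have k0 : 0 < k by rewrite invr_gt0.
have N0 : 0 < N.
  have K0 : 0 <= 4 * n%:R ^+ 2 + 8 * n%:R :> R.
    by rewrite addr_ge0 ?mulr_ge0 // sqr_ge0.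
  apply: mulr_gt0; first by rewrite ltr_pwDl.
  by rewrite ltr_pwDl // mulr_ge0 // ltW.
have eps0 : 0 < eps by rewrite powR_gt0 // divr_gt0.
have epsE : eps `^ (1 - p) * N = m.
  rewrite /eps -powRrM mulVf ?gt_eqF // powRr1 ?ltW ?divr_gt0 //.
  by rewrite divfK // gt_eqF.
pose v (x : 'rV[R]_n) t := eps * t `^ k * bell y d x.
have cap0 (w : 'rV[R]_n) : 0 <= cap y d w by rewrite /cap le_max lexx.
have bell0 (w : 'rV[R]_n) : 0 <= bell y d w.
  by rewrite /bell addr_ge0 ?cap0 // mulr_ge0 // sqr_ge0.
rewrite -/(v x t); apply: (comparison Om T r f) => //.
- by rewrite r_gt0 r_lt1.
- exact: reaction_decr.
- apply/within_continuousP => -[w s] Kws.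
  have cs : {within closure Om `*` `[0, T],
      continuous (fun z : 'rV[R]_n * R => z.2 `^ k)}.
    apply: within_continuous_powR => //.
      by apply/within_continuousP => z _; apply: cvg_within_filter; exact: cvg_snd.
    by move=> [w' s'] [_]; rewrite /= in_itv => /andP[].
  move/within_continuousP in cs.
  set F := within _ _.
  apply: (@cvgM _ _ F).
    by apply: (@cvgM _ _ F); [exact: cvg_cst|exact: (cs (w, s))].
  apply: cvg_within_filter.
  apply: (@cvg_comp _ _ _ fst (bell y d) _ (nbhs w)); last exact: bell_continuous.
  exact: cvg_fst.
- exact: u_continuous.
- by move=> w s _ /andP[s0 _]; rewrite mulr_ge0 // mulr_ge0 ?powR_ge0 // ltW.
- by move=> w s cw /andP[s0 _]; exact: u_ge0.
- move=> w s cw /andP[s0 sT] uv.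
  (* The barrier can exceed u only at a positive time inside the open ball, so the corner of the
     bell is never tested. *)
  have v0 : 0 < v w s by rewrite (le_lt_trans _ uv) // u_ge0.
  have sp : 0 < s.
    rewrite lt_neqAle s0 andbT; apply/negP => /eqP s00.
    by move: v0; rewrite /v -s00 powR0 ?gt_eqF // mulr0 mul0r ltxx.
  have cw0 : 0 < cap y d w.
    rewrite lt_neqAle cap0 andbT; apply/negP => /eqP c00.
    by move: v0; rewrite /v /bell -c00 expr0n /= mulr0 addr0 mulr0 ltxx.
  have capE : cap y d w = 1 - sqdist y w / d ^+ 2.
    move: cw0; rewrite /cap lt_max ltxx /= => h.
    by rewrite (max_idPr (ltW h)).
  have Ow : Om w.
    apply: dO; apply/eball_sqdist => //; move: cw0; rewrite capE subr_gt0.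
    by rewrite ltr_pdivrMr ?exprn_gt0 // mul1r.
  have [ut [g [D [ju eu]]]] := u_jet _ _ Ow sp.
  split => //; first exact: u_pos.
  have jb i := jet2_bell y d w i (eps * s `^ k) d0 cw0.
  exists (eps * (k * s `^ (k - 1)) * bell y d w); do 2 eexists.
  exists ut, g, D; split => //.
  + split; last by move=> i; exact: jb.
      have H1 := @is_deriveZ _ _ _ _ (eps * bell y d w) _ _ _ (is_derive1_powR k sp).
      have -> : v w = (eps * bell y d w) \*: (@powR R ^~ k).
        by apply/funext => t'; rewrite /v mulrAC.
      by apply: is_derive_eq H1 _; rewrite -![_ *: _]/(_ * _); ring.
  + apply: (@le_trans _ _ (m * (v w s) `^ p)); last first.
      by rewrite ler_wpDr ?powR_ge0 // ler_wpM2r ?powR_ge0 // am.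
    have := @barrier_subsolution c eps (cap y d w) (sqdist y w) d s.
    move=> H.
    apply: le_trans (H _ _ _ _ _ _ _ _) => //.
    * rewrite lerD2l lerN2 -mulr_sumr ler_wpM2l ?mulr_ge0 ?powR_ge0 ?(ltW eps0) //.
      rewrite big_split /= sumr_const card_ord -mulr_sumr.
      have -> : \sum_i (2 * (w - y) ord0 i / d ^+ 2) ^+ 2 = 4 / d ^+ 4 * sqdist y w.
        rewrite /sqdist mulr_sumr; apply: eq_bigr => i _.
        by field; rewrite gt_eqF.
      rewrite -mulr_natr le_eqVlt; apply/orP; left; apply/eqP; ring.
    * by rewrite cap0 /= capE gerBl divr_ge0 ?sqdist_ge0 // exprn_ge0 // ltW.
    * exact: le_trans sT Tc.
    * by rewrite capE opprB addrC subrK.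
  + by rewrite eu.
Qed.

(** * Convexity of the domain and parabolic dilation *)

Lemma segment_interior (y x : 'rV[R]_n) (l : R) : Om y -> closure Om x ->
  0 <= l < 1 -> Om ((1 - l) *: y + l *: x).
Proof.
move=> Oy cx /andP[l0 l1]; have l10 : 0 < 1 - l by rewrite subr_gt0.
(* [g z] is the solution of (1 - l) g z + l z = (1 - l) y + l x. As [g x = y] is in the open set,
   some [z] of the domain close to [x] has [g z] in the domain as well. *)
pose g (z : 'rV[R]_n) := - (l / (1 - l)) *: z + (y + (l / (1 - l)) *: x).
have gc : continuous g.
  move=> z; apply: (@cvgD _ _ _ (nbhs z)); last exact: cvg_cst.
  by apply: (@cvgZl_tmp _ _ _ (nbhs z)); exact: cvg_id.
have gx : g x = y by rewrite /g scaleNr addrCA addNr addr0.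
have H : nbhs x (g @^-1` Om).
  by apply: gc; rewrite gx; exact: open_nbhs_nbhs.
have [z [Oz Ogz]] := cx _ H.
have -> : (1 - l) *: y + l *: x = (1 - l) *: g z + l *: z.
  rewrite /g !scalerDr !scalerA mulrN mulrCA mulfV ?gt_eqF // mulr1 scaleNr.
  by rewrite addrAC addNr add0r.
by apply: vO => //; rewrite l0 ltW.
Qed.

(** Concavity of a^(1/sigma) on the segment from [y] to [x], with the nonnegative contribution of
    [y] discarded. *)
Lemma a_dilation (y x : 'rV[R]_n) (c : R) : Om y -> Om x -> 0 < c < 1 ->
  a x <= c^-1 `^ sg * a ((1 - c) *: y + c *: x).
Proof.
move=> Oy Ox /andP[c0 c1].
have s0 : 0 < sg by rewrite divr_gt0 ?subr_gt0 // r_gt0.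
set z := (1 - c) *: y + _; have Oz : Om z by apply: vO => //; rewrite !ltW.
have apos w : Om w -> 0 < a w by move=> /am; exact: lt_le_trans.
have H : c * a x `^ sg^-1 <= a z `^ sg^-1.
  apply: le_trans (a_conc _ _ c Oy Ox _); last by rewrite !ltW.
  by rewrite lerDr mulr_ge0 ?powR_ge0 // subr_ge0 ltW.
have aE w : Om w -> a w = (a w `^ sg^-1) `^ sg.
  by move=> /apos w0; rewrite -powRrM mulVf ?gt_eqF // powRr1 ?ltW.
rewrite (aE x) // (aE z) // -powRM ?powR_ge0 ?invr_ge0 ?(ltW c0) //.
apply: ge0_ler_powR; rewrite ?nnegrE ?powR_ge0 ?(ltW s0) //.
  by rewrite mulr_ge0 ?powR_ge0 // invr_ge0 ltW.
by rewrite [c^-1 * _]mulrC ler_pdivlMr // [_ * c]mulrC.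
Qed.

(* The right-hand side, as a function of (x, t), is a supersolution in the whole
   cylinder because a is theta-concave. *)
Lemma dilation_bound (y x : 'rV[R]_n) (c t : R) : Om y -> closure Om x ->
  0 <= t -> 0 < c < 1 ->
  u x t <= c^-1 `^ ((2 + sg) / (1 - q)) * u ((1 - c) *: y + c *: x) (c ^+ 2 * t).
Proof.
move=> Oy cx t0 /[dup] c01 /andP[c0 c1].
have s0 : 0 < sg by rewrite divr_gt0 ?subr_gt0 // r_gt0.
(* A supersolution needs M^(1-q) >= c^(-2) for the source u^q and M^(1-p) >= c^(-2-sigma) for the
   source a u^p, where a loses a factor c^sigma. The choice b (1 - q) = 2 + sigma gives both, since
   1 - p > 1 - q. *)
set b := (2 + sg) / (1 - q); set M := c^-1 `^ b.
have ci : 1 < c^-1 by rewrite invf_gt1.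
have M0 : 0 < M by rewrite powR_gt0 // (lt_trans _ ci).
pose z (w : 'rV[R]_n) (s : R) := M * u (c *: w + (1 - c) *: y) (c ^+ 2 * s + 0).
have Oz w : closure Om w -> Om (c *: w + (1 - c) *: y).
  by move=> cw; rewrite addrC; apply: segment_interior; rewrite // c1 ltW.
have -> : M * u ((1 - c) *: y + c *: x) (c ^+ 2 * t) = z x t.
  by rewrite /z addrC addr0.
have c20 s : 0 <= s -> 0 <= c ^+ 2 * s + 0.
  by move=> h; rewrite addr0 mulr_ge0 // sqr_ge0.
apply: (comparison Om t r f) => //.
- by rewrite r_gt0 r_lt1.
- exact: reaction_decr.
- exact: u_continuous.
- apply: (u_continuous_comp M _ (fun w => (c *: w.1 + (1 - c) *: y, c ^+ 2 * w.2 + 0))).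
    exact: affine_pair_continuous.
  move=> [w s] [/= cw]; rewrite in_itv /= => /andP[s00 _].
  by split; [apply: subset_closure; exact: Oz|exact: c20].
- by move=> w s cw /andP[s00 _]; exact: u_ge0.
- move=> w s cw /andP[s00 _]; rewrite mulr_ge0 ?(ltW M0) // u_ge0 ?c20 //.
  by apply: subset_closure; exact: Oz.
- move=> w s cw /andP[s00 _] zu.
  have /u_gt0[//|//|Ow s01] : 0 < u w s.
    apply: le_lt_trans zu; rewrite mulr_ge0 ?(ltW M0) // u_ge0 ?c20 //.
    by apply: subset_closure; exact: Oz.
  have s2 : 0 < c ^+ 2 * s + 0 by rewrite addr0 mulr_gt0 // exprn_gt0.
  have Ow' := Oz _ cw.
  have U0 := u_pos _ _ Ow' s2.
  split => //; first by rewrite mulr_gt0.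
  have [ut [g [D [ju eu]]]] := u_jet _ _ Ow s01.
  have [zt [g' [D' [jz ez]]]] := u_jet _ _ Ow' s2.
  exists ut, g, D, (M * (c ^+ 2 * zt)), (fun i => M * (c * g' i)),
    (fun i => M * (c ^+ 2 * D' i)); split => //.
  + exact: jet_at_affine.
  + by rewrite eu.
  + rewrite -!mulr_sumr -!mulrBr ez /z.
    move: U0 Ow' (a_dilation y w c Oy Ow c01); rewrite [c *: w + _]addrC.
    set U := u _ _; set a' := a (_ + _) => U0 Ow' ha.
    have a'0 : 0 < a' by exact: lt_le_trans m0 (am _ Ow').
    rewrite !powRM ?(ltW M0) ?(ltW U0) //.
    have cpow e1 e2 : e1 <= e2 -> c^-1 `^ e1 <= c^-1 `^ e2.
      by move=> h; apply: ler_powR => //; exact: ltW.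
    have cD e1 e2 : c^-1 `^ (e1 + e2) = c^-1 `^ e1 * c^-1 `^ e2.
      by rewrite powRD // invr_eq0 (gt_eqF c0) implybT.
    have c2 : M * c ^+ 2 = c^-1 `^ (b - 2).
      rewrite cD -/M; congr (_ * _).
      by rewrite powRN (powR_mulrn 2) ?invr_ge0 ?(ltW c0) // exprVn invrK.
    have q10 : 0 < 1 - q by rewrite subr_gt0.
    have bq : b * (1 - q) = 2 + sg by rewrite /b divfK // gt_eqF.
    have b0 : 0 < b by rewrite divr_gt0 // addr_gt0.
    have Mq : M `^ q <= M * c ^+ 2.
      rewrite c2 -powRrM; apply: cpow.
      move: bq s0; rewrite mulrBr mulr1; set e := sg; lra.
    have Mp : M `^ p * c^-1 `^ sg <= M * c ^+ 2.
      rewrite c2 -powRrM -cD; apply: cpow.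
      have : b * (1 - q) <= b * (1 - p) by rewrite ler_pM2l // lerD2l lerN2 ltW.
      rewrite bq mulrBr mulr1; set e := sg; lra.
    rewrite [M * (c ^+ 2 * _)]mulrA mulrDr; apply: lerD; last first.
      by rewrite ler_wpM2r ?powR_ge0.
    rewrite mulrA mulrA; apply: ler_wpM2r; first exact: powR_ge0.
    apply: (@le_trans _ _ (c^-1 `^ sg * a' * M `^ p)).
      by rewrite ler_wpM2r ?powR_ge0.
    by rewrite mulrAC [_ * M `^ p]mulrC ler_wpM2r // ltW.
- by rewrite t0 lexx.
Qed.

(** * Monotonicity and linear growth of [w] *)

Definition w (x : 'rV[R]_n) (s : R) : R := u x (s ^+ 2) `^ r.

Lemma w_ge0 x s : 0 <= w x s. Proof. exact: powR_ge0. Qed.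

Lemma w_nondecreasing (x : 'rV[R]_n) (s s' : R) : closure Om x -> 0 <= s <= s' ->
  w x s <= w x s'.
Proof.
move=> cx /andP[s0 ss']; have s'0 := le_trans s0 ss'.
apply: ge0_ler_powR; rewrite ?nnegrE ?u_ge0 ?sqr_ge0 ?(ltW r_gt0) //.
have -> : s' ^+ 2 = s ^+ 2 + (s' ^+ 2 - s ^+ 2) by rewrite addrC subrK.
apply: u_nondecreasing; rewrite ?sqr_ge0 // subr_ge0.
by rewrite ler_sqr ?nnegrE.
Qed.

(** Dilation about [x - c d], a point of the domain behind [x] on the line of direction [d]: the
    ratio c / (c + h) brings x + h d back to [x] and the time s + h s / c back to [s]. Earlier times
    follow by monotonicity. *)
Lemma w_growth (x d : 'rV[R]_n) (s : R) : Om x -> 0 < s ->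
  exists c : R, 0 < c /\ forall h s', 0 < h <= c -> closure Om (x + h *: d) ->
    0 <= s' <= s + h * (s / c) -> w (x + h *: d) s' <= (1 + 3 * h / c) * w x s.
Proof.
move=> Ox s0.
have /nbhs_ballP[e /= e0 He] := near_line _ _ d oO Ox.
pose c := e / 2; have c0 : 0 < c by rewrite divr_gt0.
have Oy : Om ((- c) *: d + x).
  apply: He; rewrite /ball /= sub0r opprK gtr0_norm // /c.
  by rewrite ltr_pdivrMr // ltr_pMr // ltr1n.
exists c; split => // h s' /andP[h0 hc] cX /andP[s'0 s's].
have ch0 : 0 < c + h by rewrite addr_gt0.
pose c' := c / (c + h).
have c'0 : 0 < c' by rewrite divr_gt0.
have c'1 : c' < 1 by rewrite ltr_pdivrMr // mul1r ltrDl.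
have s'E : s + h * (s / c) = s / c' by rewrite /c'; field; rewrite !gt_eqF.
rewrite s'E in s's.
apply: (@le_trans _ _ (w (x + h *: d) (s / c'))).
  by apply: w_nondecreasing => //; rewrite s'0.
have := dilation_bound _ _ c' ((s / c') ^+ 2) Oy cX (sqr_ge0 _).
rewrite c'0 c'1 => /(_ isT).
have -> : (1 - c') *: (- c *: d + x) + c' *: (x + h *: d) = x.
  apply/rowP => i; rewrite !mxE.
  by rewrite /c'; field; rewrite gt_eqF.
have -> : c' ^+ 2 * (s / c') ^+ 2 = s ^+ 2 by field; rewrite gt_eqF.
set b := (2 + sg) / (1 - q) => H.
have br : b * r = (2 + sg) / 2.
  by rewrite /b; field; move: q1 => ?; rewrite subr_eq0 gt_eqF.
have sg2 : sg < 1 by rewrite ltr_pdivrMr ?r_gt0 // mul1r.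
have c'i : c'^-1 = 1 + h / c by rewrite /c'; field; rewrite !gt_eqF.
have c'i1 : 1 <= c'^-1 by rewrite c'i lerDl divr_ge0 ?ltW.
have hu0 : 0 <= u x (s ^+ 2) by rewrite u_ge0 ?sqr_ge0 //; exact: subset_closure.
apply: (@le_trans _ _ ((c'^-1 `^ b * u x (s ^+ 2)) `^ r)).
  apply: ge0_ler_powR H; rewrite ?(ltW r_gt0) ?nnegrE ?u_ge0 ?sqr_ge0 //.
  by rewrite mulr_ge0 ?powR_ge0.
rewrite powRM ?powR_ge0 // -powRrM br ler_wpM2r ?powR_ge0 //.
(* The exponent b r = (2 + sigma) / 2 is below 2, and (1 + v)^2 <= 1 + 3 v for v = h / c in
   [0, 1]. *)
apply: (@le_trans _ _ (c'^-1 `^ 2)).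
  apply: ler_powR => //; rewrite ler_pdivrMr //.
  by rewrite -[2 * 2]/(2 * (1 + 1)) mulrDr mulr1 lerD2l; apply: (le_trans (ltW sg2)); rewrite ler1n.
rewrite (powR_mulrn 2) ?(le_trans _ c'i1) // c'i -[3 * h / c]mulrA.
have hc0 : 0 <= h / c by rewrite divr_ge0 ?ltW.
have hc1 : h / c <= 1 by rewrite ler_pdivrMr // mul1r.
move: (h / c) hc0 hc1 => v v0 v1; nra.
Qed.

(** * Exclusion of the parabolic boundary *)

Lemma root_not_linear (C e L d : R) : 0 < C -> e < 1 -> 0 < d ->
  (forall h, 0 < h <= d -> C * h `^ e <= L * h) -> False.
Proof.
move=> C0 e1 d0 H.
have L0 : 0 < L.
  have := H d; rewrite d0 lexx => /(_ isT) h.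
  have : 0 < L * d by apply: lt_le_trans h; rewrite mulr_gt0 ?powR_gt0.
  by rewrite pmulr_lgt0.
have e10 : 0 < 1 - e by rewrite subr_gt0.
(* At [h0] the linear bound [L h] is exactly half of [C h^e]; below [h0] it is smaller still. *)
pose h0 := (C / (2 * L)) `^ (1 - e)^-1.
have h00 : 0 < h0 by rewrite powR_gt0 // divr_gt0 // mulr_gt0.
pose h := Num.min d h0.
have hp : 0 < h by rewrite lt_min d0.
have hb : h `^ (1 - e) <= C / (2 * L).
  have -> : C / (2 * L) = h0 `^ (1 - e).
    by rewrite /h0 -powRrM mulVf ?gt_eqF // powRr1 // ltW // divr_gt0 // mulr_gt0.
  apply: ge0_ler_powR; rewrite ?nnegrE ?(ltW hp) ?(ltW h00) ?(ltW e10) //.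
  by rewrite /h ge_min lexx orbT.
have := H h; rewrite hp /h ge_min lexx => /(_ isT); rewrite -/h.
have {2}-> : h = h `^ (1 - e) * h `^ e.
  rewrite -powRD ?subrK ?powRr1 ?(ltW hp) //.
  by rewrite (gt_eqF hp) implybT.
rewrite mulrA ler_pM2r ?powR_gt0 // => h1.
have : L * h `^ (1 - e) <= C / 2.
  apply: le_trans (ler_wpM2l (ltW L0) hb) _.
  by rewrite le_eqVlt; apply/orP; left; apply/eqP; field; rewrite gt_eqF.
lra.
Qed.

(** A sup-norm ball contains the Euclidean ball of the same centre and radius. *)
Lemma open_eball (x : 'rV[R]_n) : Om x ->
  exists2 d : R, 0 < d & eball x d `<=` Om.
Proof.
move=> Ox; have /nbhs_ballP[d /= d0 Hd] : nbhs x Om by exact: open_nbhs_nbhs.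
exists d => // z /eball_sqdist-/(_ d0) zd; apply: Hd; split => // i j.
rewrite [i]ord1 /ball /= -ltr_sqr ?nnegrE ?(ltW d0) // -normrX ger0_norm ?sqr_ge0 //.
apply: le_lt_trans zd; rewrite /sqdist (bigD1 j) //= !mxE -[(z _ _ - _) ^+ 2]sqrrN opprB.
by rewrite lerDl sumr_ge0 // => ? _; exact: sqr_ge0.
Qed.

Lemma barrier_constant_gt0 (c : R) : 0 < c ->
  0 < (m / ((1 + n%:R) * (k + c * (4 * n%:R ^+ 2 + 8 * n%:R)))) `^ k.
Proof.
move=> c0; rewrite powR_gt0 // divr_gt0 //.
have K0 : 0 <= 4 * n%:R ^+ 2 + 8 * n%:R :> R.
  by rewrite addr_ge0 ?mulr_ge0 // sqr_ge0.
apply: mulr_gt0; first by rewrite ltr_pwDl.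
rewrite ltr_pwDl ?invr_gt0 ?subr_gt0 ?(lt_trans pq) //.
by rewrite mulr_ge0 // ltW.
Qed.

(** Minimality is assumed in the first point only: it bounds (1 - l) times the gain of [w] away from
    (x1, s1) by the gain at the mean point. The second point is treated by exchanging the roles of
    the two and of [l] and [1 - l]. *)
Lemma boundary_excluded (x1 x3 : 'rV[R]_n) (s1 s3 S l : R) :
  closure Om x1 -> closure Om x3 -> 0 <= s1 <= S -> 0 <= s3 <= S -> 0 < l < 1 ->
  Om ((1 - l) *: x1 + l *: x3) -> 0 < (1 - l) * s1 + l * s3 ->
  (forall y t, closure Om y -> 0 <= t <= S ->
     (1 - l) * (w y t - w x1 s1)
       <= w ((1 - l) *: y + l *: x3) ((1 - l) * t + l * s3)
          - w ((1 - l) *: x1 + l *: x3) ((1 - l) * s1 + l * s3)) ->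
  Om x1 /\ 0 < s1.
Proof.
move=> cx1 cx3 /andP[s10 s1S] /andP[s30 s3S] /andP[l0 l1].
set x2 := _ + _; set s2 := (1 - l) * s1 + l * s3 => Ox2 s20 Hmin.
have l10 : 0 < 1 - l by rewrite subr_gt0.
have S0 : 0 < S.
  apply: lt_le_trans s20 _; rewrite /s2.
  have -> : S = (1 - l) * S + l * S by ring.
  by apply: lerD; apply: ler_wpM2l => //; exact: ltW.
have r0 := r_gt0.
have Oseg (y : 'rV[R]_n) (h : R) : Om y -> 0 < h <= 1 -> Om (x1 + h *: (y - x1)).
  move=> Oy /andP[h0 h1].
  have -> : x1 + h *: (y - x1) = (1 - (1 - h)) *: y + (1 - h) *: x1.
    by apply/rowP => i; rewrite !mxE; ring.
  by apply: segment_interior => //; rewrite subr_ge0 h1 gtrBl.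
(* Moving x1 by the fraction [h] towards [y] moves the mean point by (1 - l) h (y - x1), so
   [w_growth] at the mean point yields a linear bound. *)
have key (y : 'rV[R]_n) : Om y -> exists c L : R, 0 < c /\
    forall h t, 0 < h <= c -> h <= 1 -> 0 <= t <= S ->
      t <= s1 + h * (s2 / c) -> w (x1 + h *: (y - x1)) t - w x1 s1 <= L * h.
  move=> Oy; have [c [c0 Hc]] := w_growth x2 (y - x1) s2 Ox2 s20.
  exists c, (3 / c * w x2 s2); split => // h t /andP[h0 hc] h1 tS tle.
  have Oh : Om (x1 + h *: (y - x1)) by apply: Oseg; rewrite ?h0.
  rewrite -(ler_pM2l l10); apply: le_trans (Hmin _ _ (subset_closure Oh) tS) _.
  have eX : (1 - l) *: (x1 + h *: (y - x1)) + l *: x3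
      = x2 + ((1 - l) * h) *: (y - x1).
    by apply/rowP => i; rewrite !mxE; ring.
  have OX : Om (x2 + ((1 - l) * h) *: (y - x1)).
    rewrite -eX; apply: segment_interior => //.
    by rewrite (ltW l0).
  have lh : 0 < (1 - l) * h <= c.
    by rewrite mulr_gt0 //= (le_trans _ hc) // ler_piMl ?(ltW h0) // gerBl ltW.
  have HX := Hc _ ((1 - l) * t + l * s3) lh (subset_closure OX).
  rewrite -eX in HX.
  rewrite lerBlDr; apply: le_trans (HX _) _.
    case/andP: tS => t0 tS.
    rewrite addr_ge0 ?mulr_ge0 ?(ltW l0) ?(ltW l10) //= /s2.
    have := ler_wpM2l (ltW l10) tle; rewrite /s2; move: (_ / c) => v; lra.
  rewrite le_eqVlt; apply/orP; left; apply/eqP; field; rewrite gt_eqF //.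
have [s1p|s1n] := ltP 0 s1; last first.
  have s1E : s1 = 0 by apply/eqP; rewrite eq_le s10 s1n.
  exfalso.
  have [c [L [c0 Hc]]] := key _ Ox2.
  have w10 : w x1 s1 = 0.
    by rewrite /w s1E expr0n /= u_ini // powR0 // gt_eqF.
  (* The rate at which [key] lets the time advance with [h]. *)
  pose ka := s2 / c; have ka0 : 0 < ka by rewrite divr_gt0.
  have [d d0 dO] := open_eball _ Ox2.
  pose cc := ka ^+ 2 / d ^+ 2.
  have cc0 : 0 < cc by rewrite divr_gt0 // exprn_gt0.
  have eps0 := barrier_constant_gt0 _ cc0.
  set eps := _ `^ k in eps0.
  (* The barrier is of order t^k at t = (h ka)^2, and [w] is the power [r] of u. *)
  pose e := 2 * k * r.
  have e1 : e < 1.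
    have -> : e = (1 - q) / (1 - p).
      by rewrite /e; field; rewrite subr_eq0 gt_eqF // (lt_trans pq).
    rewrite ltr_pdivrMr ?subr_gt0 ?(lt_trans pq) // mul1r.
    by rewrite ltrD2l ltrN2.
  apply: (@root_not_linear ((eps * (ka ^+ 2) `^ k) `^ r) e L
    (Num.min (Num.min c 1) (S / ka))).
  - by rewrite powR_gt0 // mulr_gt0 // powR_gt0 // exprn_gt0.
  - exact: e1.
  - by rewrite !lt_min c0 ltr01 divr_gt0.
  move=> h /andP[h0]; rewrite !le_min -andbA => /and3P[hc h1 hS].
  have hh : 0 < h <= 1 by rewrite h0.
  have t0 : 0 < h * ka by rewrite mulr_gt0.
  have := Hc h (h * ka); rewrite h0 hc h1 w10 subr0 => /(_ isT isT) HL.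
  apply: le_trans (HL _ _); last first.
  - by rewrite s1E add0r.
  - by rewrite (ltW t0) /= -ler_pdivlMr.
  have hd0 : 0 < h * d by rewrite mulr_gt0.
  (* Image of a fixed ball about x2 under the contraction of ratio [h] towards x1. Radius and square
     root of time both scale like [h], so [cc] and [eps] do not depend on [h]. *)
  have ball1 : eball (x1 + h *: (x2 - x1)) (h * d) `<=` Om.
    move=> z /eball_sqdist-/(_ hd0) zb.
    have Oz : Om (x2 + h^-1 *: (z - (x1 + h *: (x2 - x1)))).
      apply: dO; apply/eball_sqdist => //.
      rewrite -(ltr_pM2l (exprn_gt0 2 h0)) -exprMn; apply: le_lt_trans zb.
      rewrite /sqdist mulr_sumr le_eqVlt; apply/orP; left; apply/eqP.
      apply: eq_bigr => i _; rewrite !mxE; field; rewrite gt_eqF //.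
    have := Oseg _ _ Oz hh; congr Om; apply/rowP => i; rewrite !mxE.
    by field; rewrite gt_eqF.
  have Oh : Om (x1 + h *: (x2 - x1)) by exact: Oseg.
  have t20 : 0 < (h * ka) ^+ 2 by rewrite exprn_gt0.
  have := barrier (x1 + h *: (x2 - x1)) (x1 + h *: (x2 - x1)) (h * d)
    ((h * ka) ^+ 2) cc ((h * ka) ^+ 2) hd0 ball1 _ cc0 (subset_closure Oh) _.
  rewrite -/eps => Hb.
  have -> : h `^ e = ((h ^+ 2) `^ k) `^ r.
    by rewrite -(powR_mulrn _ (ltW h0)) -!powRrM /e mulrA.
  rewrite -powRM ?mulr_ge0 ?powR_ge0 ?(ltW eps0) ?(ltW h0) //.
  apply: ge0_ler_powR; rewrite ?(ltW r0) // ?nnegrE.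
  - by rewrite !mulr_ge0 ?powR_ge0 ?(ltW eps0).
  - by rewrite u_ge0 ?(ltW t20) //; exact: subset_closure.
  apply: le_trans _ (Hb _ _).
  - rewrite -mulrA -powRM ?sqr_ge0 // -exprMn [ka * h]mulrC ler_peMr //.
      by rewrite mulr_ge0 ?powR_ge0 // ltW.
    have -> : bell (x1 + h *: (x2 - x1)) (h * d) (x1 + h *: (x2 - x1)) = 1 + n%:R.
      rewrite /bell /cap /sqdist big1 => [|i _]; last by rewrite subrr mxE expr0n.
      by rewrite mul0r subr0 (max_idPr ler01) expr1n mulr1.
    by rewrite lerDl.
  - rewrite /cc le_eqVlt; apply/orP; left; apply/eqP; field; rewrite gt_eqF //.
  - by rewrite (ltW t20) lexx.
split => //; apply: contrapT => nOx1.
have w10 : w x1 s1 = 0.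
  by rewrite /w u_lat ?sqr_ge0 // powR0 // gt_eqF.
(* On the lateral boundary the time stays at s1 and x1 moves towards the centre of an interior ball
   touching it. The bell vanishes only linearly at the sphere, so [w] is at least of order h^r. *)
have [y [d [Oy d0 dO yx]]] := O_sphere _ cx1 nOx1.
have [c [L [c0 Hc]]] := key _ Oy.
have d20 : 0 < d ^+ 2 by rewrite exprn_gt0.
have s12 : 0 < s1 ^+ 2 by rewrite exprn_gt0.
pose cc := s1 ^+ 2 / d ^+ 2; have cc0 : 0 < cc by rewrite divr_gt0.
have Hb h : 0 < h <= 1 -> _ := fun hh => barrier y (x1 + h *: (y - x1)) d
  (s1 ^+ 2) cc (s1 ^+ 2) d0 dO _ cc0 (subset_closure (Oseg _ _ Oy hh)) _.
move: Hb; set eps := _ `^ k => Hb.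
have eps0 : 0 < eps by exact: barrier_constant_gt0.
apply: (@root_not_linear ((eps * (s1 ^+ 2) `^ k) `^ r) r L (Num.min c 1)).
- by rewrite powR_gt0 // mulr_gt0 // powR_gt0.
- exact: r_lt1.
- by rewrite lt_min c0 ltr01.
move=> h /andP[h0]; rewrite le_min => /andP[hc h1].
have hh : 0 < h <= 1 by rewrite h0.
have := Hc h s1; rewrite h0 hc h1 w10 subr0 => /(_ isT isT) HL.
apply: le_trans (HL _ _); last first.
- by rewrite lerDl mulr_ge0 ?(ltW h0) // divr_ge0 ?(ltW s20) // ltW.
- by rewrite s10.
have bl : h <= bell y d (x1 + h *: (y - x1)).
  have E : sqdist y (x1 + h *: (y - x1)) = (1 - h) ^+ 2 * sqdist y x1.
    rewrite /sqdist mulr_sumr; apply: eq_bigr => i _.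
    by rewrite !mxE; ring.
  have cp : h <= cap y d (x1 + h *: (y - x1)).
    rewrite /cap le_max; apply/orP; right; rewrite E.
    have : (1 - h) ^+ 2 * sqdist y x1 / d ^+ 2 <= (1 - h) ^+ 2.
      by rewrite ler_pdivrMr // ler_wpM2l // sqr_ge0.
    move: (_ / d ^+ 2) => v hv.
    have : (1 - h) ^+ 2 <= 1 - h by nra.
    lra.
  by rewrite /bell (le_trans cp) // lerDl mulr_ge0 // sqr_ge0.
rewrite -powRM ?mulr_ge0 ?powR_ge0 ?(ltW eps0) ?(ltW h0) //.
apply: ge0_ler_powR; rewrite ?(ltW r0) // ?nnegrE.
- by rewrite !mulr_ge0 ?powR_ge0 ?(ltW eps0) ?(ltW h0).
- by rewrite u_ge0 ?(ltW s12) //; apply: subset_closure; exact: Oseg.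
apply: le_trans _ (Hb _ _ h hh).
- by rewrite ler_wpM2l // mulr_ge0 ?powR_ge0 // ltW.
- by rewrite /cc divfK // gt_eqF.
- by rewrite (ltW s12) lexx.
Qed.

(** * The equation for [w] at an interior minimum *)

Lemma w_jet (x : 'rV[R]_n) (s : R) : Om x -> 0 < s -> exists vt g D,
  [/\ jet_at (fun y t => u y t `^ r) x (s ^+ 2) vt g D,
      is_derive s (1 : R) (w x) (2 * s * vt) &
      vt - \sum_i D i = r * (a x * w x s `^ (- 1 - sg) + (w x s)^-1)
        + (1 - r) / r * (\sum_i g i ^+ 2) / w x s].
Proof.
move=> Ox s0; have s20 : 0 < s ^+ 2 by rewrite exprn_gt0.
have [ut [g [D [ju eu]]]] := u_jet _ _ Ox s20.
have U0 := u_pos _ _ Ox s20; have r0 := r_gt0.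
have jv := jet_at_powR r _ _ _ _ _ _ ju U0.
do 3 eexists; split; first exact: jv.
  have [dv _] := jv.
  (* [vt] is the derivative in the original time [s ^ 2]; it plays the role of w_s / (2 s). *)
  have ds : is_derive s (1 : R) (fun s : R => s ^+ 2) (2 * s).
    have := is_deriveM (is_derive_id s (1 : R)) (is_derive_id s (1 : R)).
    by move=> H; apply: (is_derive_eq H); rewrite -![_ *: _]/(_ * _); ring.
  have := @is_derive1_comp _ (fun t => u x t `^ r) (fun s : R => s ^+ 2) s _ _ dv ds.
  by rewrite [2 * s * _]mulrC.
rewrite jet_at_powR_heat // eu; congr (_ + _).
rewrite -mulrA; congr (_ * _).
set U := u x _ in U0 *.
rewrite mulrDr mulrCA /w -/U -powRrM -powRN.
rewrite -!powRD; try by rewrite (gt_eqF U0) implybT.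
congr (_ * _ `^ _ + _ `^ _); last by field.
by field; move: q1 => ?; rewrite subr_eq0 gt_eqF.
Qed.

(** The weighted geometric mean of a^(1/sigma) and v, with weights sigma and 1 - sigma, is concave
    and increasing in both arguments. *)
Lemma source_concave (x1 x3 : 'rV[R]_n) (l v1 v3 : R) : Om x1 -> Om x3 ->
  0 < l < 1 -> 0 < v1 -> 0 < v3 ->
  (1 - l) * (a x1 * v1 `^ (1 - sg)) + l * (a x3 * v3 `^ (1 - sg))
    <= a ((1 - l) *: x1 + l *: x3) * ((1 - l) * v1 + l * v3) `^ (1 - sg).
Proof.
move=> Ox1 Ox3 /[dup] l01 /andP[l0 l1] v10 v30.
have s0 : 0 < sg by rewrite divr_gt0 ?subr_gt0 // r_gt0.
have s1 : sg < 1 by rewrite ltr_pdivrMr ?r_gt0 // mul1r.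
have apos w : Om w -> 0 < a w by move=> /am; exact: lt_le_trans.
have aE w : Om w -> a w = (a w `^ sg^-1) `^ sg.
  by move=> /apos w0; rewrite -powRrM mulVf ?gt_eqF // powRr1 ?ltW.
have l01' : 0 <= l <= 1 by rewrite !ltW.
have Oz : Om ((1 - l) *: x1 + l *: x3) by apply: vO.
rewrite (aE x1) // (aE x3) // (aE (_ + _)) //.
apply: le_trans (geometric_mean_concave _ _ _ _ _ _ _ l01 _ _ _ _) _;
  rewrite ?s0 ?powR_gt0 ?apos //.
apply: ler_wpM2r; first exact: powR_ge0.
apply: ge0_ler_powR; rewrite ?nnegrE ?powR_ge0 ?(ltW s0) //.
  by rewrite addr_ge0 ?mulr_ge0 ?powR_ge0 ?(ltW l0) // subr_ge0 ltW.
exact: a_conc.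
Qed.

Lemma interior_minimum (x1 x3 : 'rV[R]_n) (s1 s3 S l : R) :
  Om x1 -> Om x3 -> 0 < s1 <= S -> 0 < s3 <= S -> 0 < l < 1 ->
  (forall y t y' t', closure Om y -> closure Om y' -> 0 <= t <= S -> 0 <= t' <= S ->
     w ((1 - l) *: x1 + l *: x3) ((1 - l) * s1 + l * s3)
       - (1 - l) * w x1 s1 - l * w x3 s3
     <= w ((1 - l) *: y + l *: y') ((1 - l) * t + l * t')
       - (1 - l) * w y t - l * w y' t') ->
  (1 - l) * w x1 s1 + l * w x3 s3
    <= w ((1 - l) *: x1 + l *: x3) ((1 - l) * s1 + l * s3).
Proof.
move=> Ox1 Ox3 /andP[s10 s1S] /andP[s30 s3S] /[dup] l01 /andP[l0 l1].
set x2 := (1 - l) *: x1 + l *: x3; set s2 := (1 - l) * s1 + l * s3 => Hmin.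
have l10 : 0 < 1 - l by rewrite subr_gt0.
have r0 := r_gt0; have r1 := r_lt1.
have s20 : 0 < s2 by rewrite addr_gt0 // mulr_gt0.
have Ox2 : Om x2 by apply: vO; rewrite // !ltW.
have [t1 [g1 [D1 [[_ j1] d1 e1]]]] := w_jet _ _ Ox1 s10.
have [t2 [g2 [D2 [[_ j2] d2 e2]]]] := w_jet _ _ Ox2 s20.
have [t3 [g3 [D3 [[_ j3] d3 e3]]]] := w_jet _ _ Ox3 s30.
have wpos x s : Om x -> 0 < s -> 0 < w x s.
  by move=> Ox s0; rewrite powR_gt0 // u_pos // exprn_gt0.
have w1p := wpos _ _ Ox1 s10; have w2p := wpos _ _ Ox2 s20.
have w3p := wpos _ _ Ox3 s30.
rewrite leNgt; apply/negP => Hneg.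
have cl x : Om x -> closure Om x by exact: subset_closure.
have S1 : 0 <= s1 <= S by rewrite ltW.
have S3 : 0 <= s3 <= S by rewrite ltW.
(* Displacing x1 and x3 by [c1 h] and [c3 h] displaces the mean point by their mean. The weights (1,
   0) and (0, 1) will identify the gradients; (w1, w3) will compare the Laplacians. *)
have Hx (c1 c3 : R) i :
    (1 - l) * (c1 * g1 i) + l * (c3 * g3 i) = ((1 - l) * c1 + l * c3) * g2 i /\
    (1 - l) * (c1 ^+ 2 * D1 i) + l * (c3 ^+ 2 * D3 i)
      <= ((1 - l) * c1 + l * c3) ^+ 2 * D2 i.
  set c2 := (1 - l) * c1 + l * c3.
  pose e : 'rV[R]_n := delta_mx ord0 i.
  have J := jet2_lin 1 (-1) _ _ _ _ _ _
    (jet2_lin (1 - l) l _ _ _ _ _ _ (jet2_scale c1 _ _ _ (j1 i))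
       (jet2_scale c3 _ _ _ (j3 i)))
    (jet2_scale c2 _ _ _ (j2 i)).
  have near_scaled (c : R) x : Om x -> \forall h \near (0 : R), Om ((c * h) *: e + x).
    move=> Ox; have := near_line _ _ (c *: e) oO Ox.
    by apply: filterS => h; rewrite scalerA mulrC.
  have N1 := near_scaled c1 _ Ox1; have N3 := near_scaled c3 _ Ox3.
  have [|h1 h2] := jet2_max _ _ _ J; last first.
    move: h1 h2; rewrite !mul1r !mulN1r subr_le0 => /eqP; rewrite subr_eq0 => /eqP.
    by split.
  near=> h.
  have O1 : Om ((c1 * h) *: e + x1) by near: h; exact: N1.
  have O3 : Om ((c3 * h) *: e + x3) by near: h; exact: N3.
  have := Hmin _ s1 _ s3 (cl _ O1) (cl _ O3) S1 S3.
  have -> : (1 - l) *: ((c1 * h) *: e + x1) + l *: ((c3 * h) *: e + x3)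
      = (c2 * h) *: e + x2.
    by apply/rowP => j; rewrite !mxE /c2; ring.
  by rewrite -/s2 -/e !mulr0 !scale0r !add0r !mul1r !mulN1r; exact: sub_le_swap.
have Gx i : g1 i = g2 i /\ g3 i = g2 i.
  have [h1 _] := Hx 1 0 i; have [h3 _] := Hx 0 1 i.
  move: h1 h3; rewrite !mul1r !mulr1 !mul0r !mulr0 !addr0 !add0r.
  by split; [apply: (mulfI (lt0r_neq0 l10))|apply: (mulfI (lt0r_neq0 l0))].
(* only left increments in time are allowed, since s1 or s3 may equal S *)
have Ht1 : 0 <= (1 - l) * (2 * s1 * t1) - (1 - l) * (2 * s2 * t2).
  have A : is_derive s1 (1 : R)
      ((1 - l) \*: w x1 - (fun s => w x2 ((1 - l) * s + l * s3)))
      ((1 - l) * (2 * s1 * t1) - (1 - l) * (2 * s2 * t2)).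
    exact: (is_deriveB (@is_deriveZ _ _ _ _ (1 - l) _ _ _ d1)
      (is_derive_affine _ _ _ _ _ d2)).
  apply: (is_derive_ge0_left _ _ _ A); near=> h.
  have h0 : h < 0 by near: h; exact: nbhs_left_lt.
  have hs : - s1 < h by near: h; apply: nbhs_left_gt; rewrite oppr_lt0.
  have hS1 : 0 <= h + s1 <= S.
    by rewrite -lerBlDr sub0r (ltW hs) (le_trans _ s1S) // gerDr ltW.
  have := Hmin x1 (h + s1) x3 s3 (cl _ Ox1) (cl _ Ox3) hS1 S3; rewrite -/x2 -/s2.
  exact: sub_le_swapl.
have Ht3 : 0 <= l * (2 * s3 * t3) - l * (2 * s2 * t2).
  have A : is_derive s3 (1 : R)
      (l \*: w x3 - (fun s => w x2 (l * s + (1 - l) * s1)))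
      (l * (2 * s3 * t3) - l * (2 * s2 * t2)).
    have d2' : is_derive (l * s3 + (1 - l) * s1) (1 : R) (w x2) (2 * s2 * t2).
      by rewrite addrC.
    exact: (is_deriveB (@is_deriveZ _ _ _ _ l _ _ _ d3)
      (is_derive_affine _ _ _ _ _ d2')).
  apply: (is_derive_ge0_left _ _ _ A); near=> h.
  have h0 : h < 0 by near: h; exact: nbhs_left_lt.
  have hs : - s3 < h by near: h; apply: nbhs_left_gt; rewrite oppr_lt0.
  have hS3 : 0 <= h + s3 <= S.
    by rewrite -lerBlDr sub0r (ltW hs) (le_trans _ s3S) // gerDr ltW.
  have := Hmin x1 s1 x3 (h + s3) (cl _ Ox1) (cl _ Ox3) S1 hS3; rewrite -/x2 -/s2.
  move/sub_le_swapr; rewrite /s2.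
  by rewrite [_ + l * (h + s3)]addrC [_ + l * s3]addrC.
(* This sign is what allows the convexity inequality for w^2/s to be multiplied by the time
   derivative at the mean point. *)
have Ht2 : 0 <= 2 * s2 * t2.
  apply: (is_derive_ge0_left _ _ _ d2); near=> h.
  have h0 : h < 0 by near: h; exact: nbhs_left_lt.
  have hs : - s2 < h by near: h; apply: nbhs_left_gt; rewrite oppr_lt0.
  apply: w_nondecreasing; first exact: cl.
  by rewrite -lerBlDr sub0r (ltW hs) gerDr ltW.
set w1 := w x1 s1 in w1p e1 Hneg *; set w3 := w x3 s3 in w3p e3 Hneg *.
set w2 := w x2 s2 in w2p e2 Hneg *.
pose W := (1 - l) * w1 + l * w3; rewrite -/W in Hneg.
have W0 : 0 < W by rewrite addr_gt0 // mulr_gt0.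
pose eta := 2 * s2 * t2.
have h1 : w1 ^+ 2 * t1 >= eta / 2 * (w1 ^+ 2 / s1).
  have h : eta <= 2 * s1 * t1 by rewrite -(ler_pM2l l10) -subr_ge0.
  have -> : w1 ^+ 2 * t1 = 2 * s1 * t1 / 2 * (w1 ^+ 2 / s1).
    by field; rewrite gt_eqF.
  by rewrite ler_wpM2r ?ler_wpM2r // divr_ge0 ?sqr_ge0 // ltW.
have h3 : w3 ^+ 2 * t3 >= eta / 2 * (w3 ^+ 2 / s3).
  have h : eta <= 2 * s3 * t3 by rewrite -(ler_pM2l l0) -subr_ge0.
  have -> : w3 ^+ 2 * t3 = 2 * s3 * t3 / 2 * (w3 ^+ 2 / s3).
    by field; rewrite gt_eqF.
  by rewrite ler_wpM2r ?ler_wpM2r // divr_ge0 ?sqr_ge0 // ltW.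
have h2 : W ^+ 2 * t2 = eta / 2 * (W ^+ 2 / s2).
  by rewrite /eta; field; rewrite gt_eqF.
have ht : W ^+ 2 * t2 <= (1 - l) * (w1 ^+ 2 * t1) + l * (w3 ^+ 2 * t3).
  have hP := square_over_linear_convex l w1 s1 w3 s3 l01 s10 s30.
  have eta0 : 0 <= eta / 2 by rewrite divr_ge0.
  have k1 := ler_wpM2l (ltW l10) h1; have k3 := ler_wpM2l (ltW l0) h3.
  have k2 := ler_wpM2l eta0 hP; rewrite -/W -/s2 -h2 in k2.
  apply: le_trans k2 _; apply: le_trans (lerD k1 k3).
  by rewrite le_eqVlt; apply/orP; left; apply/eqP; ring.
pose G := \sum_i g2 i ^+ 2.
have G0 : 0 <= G by apply: sumr_ge0 => i _; exact: sqr_ge0.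
have EG1 : \sum_i g1 i ^+ 2 = G by apply: eq_bigr => i _; rewrite (Gx i).1.
have EG3 : \sum_i g3 i ^+ 2 = G by apply: eq_bigr => i _; rewrite (Gx i).2.
rewrite EG1 in e1; rewrite EG3 in e3; rewrite -/G in e2.
have hL : (1 - l) * (w1 ^+ 2 * \sum_i D1 i) + l * (w3 ^+ 2 * \sum_i D3 i)
    <= W ^+ 2 * \sum_i D2 i.
  rewrite !mulr_sumr -big_split /=; apply: ler_sum => i _.
  exact: (Hx w1 w3 i).2.
pose K := (1 - r) / r * G.
have K0 : 0 <= K by rewrite mulr_ge0 // divr_ge0 ?subr_ge0 // ltW.
have src (v : R) : 0 < v -> v ^+ 2 * v `^ (-1 - sg) = v `^ (1 - sg).
  move=> v0; rewrite -(powR_mulrn _ (ltW v0)) -powRD.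
    by congr (_ `^ _); ring.
  by rewrite (gt_eqF v0) implybT.
have E (v A tt Ds : R) : 0 < v ->
    tt - Ds = r * (A * v `^ (-1 - sg) + v^-1) + (1 - r) / r * G / v ->
    v ^+ 2 * Ds = v ^+ 2 * tt - (r * (A * v `^ (1 - sg) + v) + K * v).
  move=> v0 H; rewrite -(src v v0).
  have -> : Ds = tt - (tt - Ds) by rewrite opprB addrC subrK.
  rewrite H /K; move: (v `^ _) ((1 - r) / r) => X Y.
  by field; rewrite gt_eqF.
have E1 := E _ _ _ _ w1p e1; have E3 := E _ _ _ _ w3p e3.
(* Negativity of the minimum means w2 < W. Replacing w2 by [W] lowers every term of the right-hand
   side, strictly for 1/w, and this gives the strict inequality. *)
have E2 : W ^+ 2 * \sum_i D2 i
    < W ^+ 2 * t2 - (r * (a x2 * W `^ (1 - sg) + W) + K * W).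
  have -> : \sum_i D2 i = t2 - (t2 - \sum_i D2 i) by ring.
  rewrite e2 mulrBr ltrD2l ltrN2.
  have a2 : 0 < a x2 by exact: lt_le_trans m0 (am _ Ox2).
  have sg0 : 0 < sg by rewrite divr_gt0 ?subr_gt0.
  have b1 : W `^ (1 - sg) <= W ^+ 2 * w2 `^ (-1 - sg).
    rewrite -(src W W0) ler_wpM2l ?sqr_ge0 //.
    apply/ltW/gt0_gtr_powR; last by rewrite w2p.
    by rewrite -opprD oppr_lt0 addr_gt0.
  have b2 : W < W ^+ 2 * w2^-1.
    by rewrite expr2 -mulrA ltr_pMr // ltr_pdivlMr // mul1r.
  have -> : W ^+ 2 * (r * (a x2 * w2 `^ (-1 - sg) + w2^-1) + (1 - r) / r * G / w2)
     = r * (a x2 * (W ^+ 2 * w2 `^ (-1 - sg)) + W ^+ 2 * w2^-1) + K * (W ^+ 2 * w2^-1).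
    by rewrite /K; ring.
  apply: ltr_leD; last by rewrite ler_wpM2l // ltW.
  rewrite ltr_pM2l //; apply: ler_ltD => //.
  by rewrite ler_wpM2l // ltW.
have hS := source_concave x1 x3 l w1 w3 Ox1 Ox3 l01 w1p w3p.
rewrite -/x2 -/W in hS; rewrite E1 E3 in hL.
exact: (averaged_balance_absurd _ _ _ _ _ _ _ _ _ _ _ _ hL E2 ht
  (ler_wpM2l (ltW r0) hS)).
Unshelve. all: by end_near. Qed.

(** * Existence of the minimum and concavity of [w] *)

Lemma closure_segment (x1 x3 : 'rV[R]_n) (l : R) : closure Om x1 -> closure Om x3 ->
  0 < l < 1 -> closure Om ((1 - l) *: x1 + l *: x3).
Proof.
move=> c1 c3 /andP[l0 l1] B HB.
pose g (z : 'rV[R]_n * 'rV[R]_n) := (1 - l) *: z.1 + l *: z.2.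
have gc : g @ ((x1, x3) : 'rV[R]_n * 'rV[R]_n) --> g (x1, x3).
  by apply: cvgD; apply: cvgZl_tmp; [exact: cvg_fst|exact: cvg_snd].
have [[A1 A3] /= [H1 H3] HA] := gc _ HB.
have [z1 [i1 A1z]] := c1 _ H1; have [z3 [i3 A3z]] := c3 _ H3.
exists (g (z1, z3)); split; last exact: (HA (z1, z3)).
by apply: vO; rewrite // !ltW.
Qed.

Lemma w_eq0 (x : 'rV[R]_n) (s : R) : closure Om x -> 0 <= s ->
  ~ (Om x /\ 0 < s) -> w x s = 0.
Proof.
move=> cx; rewrite le_eqVlt => /predU1P[<-|s0] H.
  by rewrite /w expr0n /= u_ini // powR0 // gt_eqF // r_gt0.
rewrite /w u_lat ?sqr_ge0 ?powR0 ?gt_eqF ?r_gt0 // => Ox.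
by apply: H.
Qed.

Lemma w_continuous (S : R) : {within closure Om `*` `[0, S],
  continuous (fun y : 'rV[R]_n * R => w y.1 y.2)}.
Proof.
apply: within_continuous_powR; first exact: r_gt0.
  apply: (within_comp_continuous _ _ (fun y : 'rV[R]_n * R => (y.1, y.2 ^+ 2)) _ u_cont).
    move=> y.
    have H1 : fst @ y --> y.1 by exact: cvg_fst.
    have H2 : (fun x : 'rV[R]_n * R => x.2 ^+ 2) @ y --> y.2 ^+ 2.
      by apply: cvgM; exact: cvg_snd.
    exact: (cvg_pair H1 H2).
  by move=> [y s] [/= cy _]; rewrite in_itv /= sqr_ge0.
by move=> [y s] [/= cy _]; rewrite u_ge0 // sqr_ge0.
Qed.

Lemma w_concave (x1 x3 : 'rV[R]_n) (s1 s3 l : R) : closure Om x1 -> closure Om x3 ->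
  0 <= s1 -> 0 <= s3 -> 0 <= l <= 1 ->
  (1 - l) * w x1 s1 + l * w x3 s3
    <= w ((1 - l) *: x1 + l *: x3) ((1 - l) * s1 + l * s3).
Proof.
move=> cx1 cx3 s10 s30 /andP[]; rewrite le_eqVlt => /predU1P[<- _|l0].
  by rewrite subr0 !scale0r !mul0r !scale1r !mul1r !addr0.
rewrite le_eqVlt => /predU1P[->|l1].
  by rewrite subrr !scale0r !mul0r !scale1r !mul1r !add0r.
have l10 : 0 < 1 - l by rewrite subr_gt0.
have l01 : 0 < l < 1 by rewrite l0.
rewrite leNgt; apply/negP => Hneg0.
(* A finite horizon containing both times, so that the concavity function has a minimum on a compact
   set. *)
pose S := s1 + s3 + 1.
pose K : set ('rV[R]_n * R) := closure Om `*` `[0, S]%classic.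
have KE (y : 'rV[R]_n) (s : R) : K (y, s) <-> closure Om y /\ 0 <= s <= S.
  by rewrite /K /= in_itv.
pose mix (z : ('rV[R]_n * R) * ('rV[R]_n * R)) : 'rV[R]_n * R :=
  ((1 - l) *: z.1.1 + l *: z.2.1, (1 - l) * z.1.2 + l * z.2.2).
pose C (z : ('rV[R]_n * R) * ('rV[R]_n * R)) : R :=
  w (mix z).1 (mix z).2 - (1 - l) * w z.1.1 z.1.2 - l * w z.2.1 z.2.2.
have mixK z : (K `*` K) z -> K (mix z).
  move: z => [[y t] [y' t']] [/= /KE[cy /andP[t0 tS]] /KE[cy' /andP[t'0 t'S]]].
  apply/KE; split; first exact: closure_segment.
  have h1 := ler_wpM2l (ltW l10) tS; have h2 := ler_wpM2l (ltW l0) t'S.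
  rewrite addr_ge0 ?mulr_ge0 ?(ltW l0) ?(ltW l10) //=.
  have -> : S = (1 - l) * S + l * S by ring.
  exact: lerD.
have mixc : continuous mix := convex_combination_continuous (1 - l) l.
have Cc : {within K `*` K, continuous C}.
  have wc := w_continuous S.
  have comp (g : ('rV[R]_n * R) * ('rV[R]_n * R) -> 'rV[R]_n * R) : continuous g ->
      (forall z, (K `*` K) z -> K (g z)) -> forall z, (K `*` K) z ->
      w (g y).1 (g y).2 @[y --> within (K `*` K) (nbhs z)] --> w (g z).1 (g z).2.
    move=> cg gK; apply/(within_continuousP (K `*` K) (fun y => w (g y).1 (g y).2)).
    exact: (within_comp_continuous _ _ _ _ wc cg gK).
  have c2 := comp mix mixc mixK.
  have c1 := comp fst (fun z => cvg_fst) (fun z H => H.1).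
  have c3 := comp snd (fun z => cvg_snd) (fun z H => H.2).
  apply/within_continuousP => z Kz.
  apply: cvgB; last by apply: cvgM; [exact: cvg_cst|exact: c3].
  by apply: cvgB; [exact: c2|apply: cvgM; [exact: cvg_cst|exact: c1]].
have K1 : K (x1, s1).
  by apply/KE; split => //; rewrite s10 /= /S -addrA lerDl addr_ge0.
have K3 : K (x3, s3).
  by apply/KE; split => //; rewrite s30 /= /S addrAC lerDr addr_ge0.
have cK : compact K by apply: compact_setX => //; exact: segment_compact.
have [[[a1 t1] [a3 t3]] cin Cmin] :
    exists2 c, c \in K `*` K & forall z, z \in K `*` K -> C c <= C z.
  apply: compact_EVT_min Cc; first by exists ((x1, s1), (x3, s3)).
  exact: compact_setX.
move: cin; rewrite inE /= => -[/KE[ca1 /andP[t10 t1S]] /KE[ca3 /andP[t30 t3S]]].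
have {}Cmin y t y' t' : closure Om y -> closure Om y' -> 0 <= t <= S ->
    0 <= t' <= S -> C ((a1, t1), (a3, t3)) <= C ((y, t), (y', t')).
  by move=> cy cy' tS t'S; apply: Cmin; rewrite inE; split; apply/KE.
have Hneg1 : C ((a1, t1), (a3, t3)) < 0.
  apply: le_lt_trans (Cmin _ _ _ _ cx1 cx3 ((KE _ _).1 K1).2 ((KE _ _).1 K3).2) _.
  by rewrite /C /mix /= -addrA -opprD subr_lt0.
move: Hneg1; rewrite {1}/C /mix /=; set x2 := (1 - l) *: a1 + l *: a3.
set s2 := (1 - l) * t1 + l * t3 => Hneg.
have w20 : 0 <= w x2 s2 by exact: w_ge0.
have s20 : 0 <= s2 by rewrite addr_ge0 // mulr_ge0 // ltW.
(* If the mean point were on the parabolic boundary, so would be both outer points, where [w]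
   vanishes, and the minimum would be nonnegative. *)
have [Ox2 s2p] : Om x2 /\ 0 < s2.
  apply: contrapT => n2.
  have z1 : w a1 t1 = 0.
    apply: w_eq0 => // -[i1 tp]; apply: n2; split.
      by apply: segment_interior; rewrite // (ltW l0).
    by rewrite ltr_pwDl ?mulr_gt0 // mulr_ge0 // ltW.
  have z3 : w a3 t3 = 0.
    apply: w_eq0 => // -[i3 tp]; apply: n2; split.
      have -> : x2 = (1 - (1 - l)) *: a3 + (1 - l) *: a1.
        by rewrite /x2 addrC; congr (_ *: _ + _); ring.
      by apply: segment_interior; rewrite // (ltW l10) gtrBl.
    by rewrite ltr_pwDr ?mulr_gt0 // mulr_ge0 // ltW.
  by move: Hneg; rewrite z1 z3 !mulr0 !subr0 ltNge w20.
have t1' : 0 <= t1 <= S by rewrite t10.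
have t3' : 0 <= t3 <= S by rewrite t30.
have [i1 t1p] : Om a1 /\ 0 < t1.
  apply: (boundary_excluded a1 a3 t1 t3 S l) => // y t cy tS.
  have := Cmin y t a3 t3 cy ca3 tS t3'; rewrite /C /mix /=; lra.
have [i3 t3p] : Om a3 /\ 0 < t3.
  have xE y : (1 - (1 - l)) *: y + (1 - l) *: a1 = (1 - l) *: a1 + l *: y.
    by rewrite addrC; congr (_ + _ *: _); ring.
  have sE t : (1 - (1 - l)) * t + (1 - l) * t1 = (1 - l) * t1 + l * t by ring.
  apply: (boundary_excluded a3 a1 t3 t1 S (1 - l)); rewrite ?xE ?sE //.
    by rewrite l10 gtrBl.
  move=> y t cy tS; rewrite xE sE.
  have := Cmin a1 t1 y t ca1 cy t1' tS; rewrite /C /mix /=; lra.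
have := interior_minimum a1 a3 t1 t3 S l i1 i3 _ _ l01 _.
rewrite t1p t3p t1S t3S -/x2 -/s2 => /(_ isT isT) H.
suff : (1 - l) * w a1 t1 + l * w a3 t3 <= w x2 s2 by move: Hneg; lra.
by apply: H => y t y' t' cy cy' tS t'S; exact: (Cmin y t y' t').
Qed.

End Problem.

(** * From the stated hypotheses to the parabolic problem *)

Lemma convex_setP {R : realType} {E : lmodType R} (D : set E) (x y : E) (l : R) :
  convex_set D -> D x -> D y -> 0 <= l <= 1 -> D ((1 - l) *: x + l *: y).
Proof.
move=> cD Dx Dy /andP[l0 l1]; rewrite addrC.
have := cD y x (Itv01 l0 l1); rewrite !inE => /(_ Dy Dx).
exact.
Qed.

Lemma concave_functionP {R : realType} {E : lmodType R} (D : set E) (f : E -> R) :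
  concave_function D f <-> forall x y (l : R), D x -> D y -> 0 <= l <= 1 ->
    (1 - l) * f x + l * f y <= f ((1 - l) *: x + l *: y).
Proof.
split=> [cf x y l Dx Dy /andP[l0 l1]|cf t x y].
  have := cf (Itv01 l0 l1) y x; rewrite !inE => /(_ Dy Dx).
  rewrite convRE /= !mulrN -opprD lerN2 [l * _ + _]addrC => h.
  by apply: le_trans h _; rewrite addrC.
rewrite !inE => Dx Dy; rewrite convRE /= !mulrN -opprD lerN2.
have := cf y x t%:num Dy Dx; rewrite ge0 le1 => /(_ isT).
by rewrite addrC [_ *: y + _]addrC.
Qed.

Lemma compact_closure {R : realType} {n : nat} (Om : set 'rV[R]_n) :
  bounded_set Om -> compact (closure Om).
Proof.
move=> [M [Mr HM]]; apply: bounded_closed_compact; last exact: closed_closure.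
exists M; split => // N MN x cx.
rewrite /= leNgt; apply/negP => Nx.
have e0 : 0 < `|x| - N by rewrite subr_gt0.
have [z [Oz xz]] := cx _ (nbhsx_ballx x _ e0).
have zN : `|z| <= N := HM N MN z Oz.
move: zN; rewrite leNgt => /negP; apply.
move: xz; rewrite -ball_normE /= => xz.
have := ler_distD z x 0; rewrite !subr0; lra.
Qed.

(** The difference quotients of the restriction to the line are those of the directional
    derivative. *)
Lemma is_derive_line {R : realType} {V : normedModType R} (f : V -> R) (x e : V) (h : R) :
  derivable f (h *: e + x) e ->
  is_derive h (1 : R) (fun s : R => f (s *: e + x)) ('D_e f (h *: e + x)).
Proof.
move=> df.
have E : (fun s : R => s^-1 *: (((fun s : R => f (s *: e + x)) \o shift h) (s *: 1)
    - f (h *: e + x)))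
  = (fun s : R => s^-1 *: ((f \o shift (h *: e + x)) (s *: e) - f (h *: e + x))).
  apply/funext => s /=; congr (_ *: (f _ - _)).
  by rewrite [s *: 1]mulr1 scalerDl addrA.
by split; rewrite ?/derivable ?/derive E.
Qed.

Lemma Ck2_jet2 {R : realType} {n : nat} (Om : set 'rV[R]_n) (f : 'rV[R]_n -> R)
    (x : 'rV[R]_n) i : open Om -> Ck 2 Om f -> Om x ->
  jet2 (fun h => f (h *: delta_mx ord0 i + x)) (partial i f x)
    (partial i (partial i f) x).
Proof.
move=> oO [_ /(_ i)[df [_ /(_ i)[ddf _]]]] Ox.
exists (fun h => partial i f (h *: delta_mx ord0 i + x)); split.
- have H := near_line _ _ (delta_mx ord0 i) oO Ox.
  apply: filterS H => h Oh; apply: is_derive_line; exact: df.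
- by rewrite scale0r add0r.
- have := @is_derive_line _ _ (partial i f) x (delta_mx ord0 i) 0.
  by rewrite scale0r add0r; apply; exact: ddf.
Qed.

Lemma closure_eball_sqdist {R : realType} {n : nat} (y x : 'rV[R]_n) (d : R) :
  0 < d -> closure (eball y d) x -> sqdist y x <= d ^+ 2.
Proof.
move=> d0 cx; rewrite leNgt; apply/negP => h.
have [z [/eball_sqdist-/(_ d0) zd]] := cx _ (sqdist_continuous y x _ (lt_nbhsr h)).
by rewrite /= ltNge (ltW zd).
Qed.

(** Concavity of a power passes to smaller positive exponents, because f^t = (f^s)^(t/s) and the
    power t/s <= 1 is concave and increasing. The infinite exponent is the constant case. *)
Lemma power_concave_le {R : realType} {E : lmodType R} (D : set E) (f : E -> R)
    (t : R) (T : \bar R) : 0 < t -> (t%:E <= T)%E -> (forall x, D x -> 0 < f x) ->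
  power_concave T D f -> forall x y (l : R), D x -> D y -> 0 <= l <= 1 ->
  D ((1 - l) *: x + l *: y) ->
  (1 - l) * f x `^ t + l * f y `^ t <= f ((1 - l) *: x + l *: y) `^ t.
Proof.
move=> t0 tT f0 [_ fT] x y l Dx Dy l01 Dz.
case: T tT fT => [s||] //=; last first.
  by move=> _ [c fc]; rewrite !fc // -mulrDl subrK mul1r.
rewrite lee_fin => ts [s0 /concave_functionP/(_ x y l Dx Dy l01) H].
have fE z : D z -> f z `^ t = (f z `^ s) `^ (t / s).
  by move=> Dz'; rewrite -powRrM mulrC divfK ?gt_eqF.
case/andP: l01; rewrite le_eqVlt => /predU1P[<- _|l0].
  by rewrite subr0 !scale0r !mul0r scale1r mul1r !addr0.
rewrite le_eqVlt => /predU1P[->|l1].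
  by rewrite subrr !scale0r !mul0r scale1r mul1r !add0r.
move: ts; rewrite le_eqVlt => /predU1P[->//|ts].
rewrite !fE //; set e := t / s.
have e01 : 0 < e < 1 by rewrite divr_gt0 //= ltr_pdivrMr // mul1r.
have l01 : 0 < l < 1 by rewrite l0.
have p z : D z -> 0 < f z `^ s by move=> Dz'; rewrite powR_gt0 // f0.
(* With second argument 1, the geometric mean inequality is the concavity of the power [e]. *)
have := geometric_mean_concave _ _ _ _ _ _ e01 l01 (p _ Dx) ltr01 (p _ Dy) ltr01.
rewrite !mulr1 subrK !powR1 !mulr1 => h; apply: le_trans h _.
apply: ge0_ler_powR => //.
- by case/andP: e01 => /ltW.
- by rewrite nnegrE addr_ge0 ?mulr_ge0 ?powR_ge0 ?(ltW l0) // subr_ge0 ltW.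
- by rewrite nnegrE powR_ge0.
Qed.

Theorem theorem1p6 (R : realType) (n : nat) (hn : (2 <= n)%N)
  (Omega : set 'rV[R]_n)
  (Omega_domain : domain Omega)
  (Omega_bounded : bounded_set Omega)
  (Omega_convex : convex_set Omega)
  (Omega_sphere : interior_sphere Omega)
  (p q : R)
  (hq : 1 / 3 < q < 1)
  (hp : (3 * q - 1) / 2 < p < q)
  (a : 'rV[R]_n -> R)
  (u : 'rV[R]_n -> R -> R)
  (u_C2x : forall t, 0 < t -> Ck 2 Omega (fun x => u x t))
  (u_C1x : forall t, 0 < t -> C1_closure Omega (fun x => u x t))
  (u_C1t : forall x, Omega x -> C1_pos (u x))
  (u_cont : {within closure Omega `*` `[0, +oo[,
               continuous (fun z : 'rV[R]_n * R => u z.1 z.2)})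
  (u_pos : forall x t, Omega x -> 0 < t -> 0 < u x t)
  (u_eq : forall x t, Omega x -> 0 < t ->
     derive1 (u x) t - laplacian (fun y => u y t) x
       = a x * u x t `^ p + u x t `^ q)
  (u_lateral : forall x t, boundary Omega x -> 0 <= t -> u x t = 0)
  (u_initial : forall x, closure Omega x -> u x 0 = 0)
  (a_measurable : lebesgue_measurable_on Omega a)
  (m : R) (m_pos : 0 < m)
  (a_lower : forall x, Omega x -> m <= a x)
  (theta : \bar R)
  (htheta : (((1 - q) / (2 * (q - p)))%:E <= theta)%E)
  (a_concave : power_concave theta Omega a) :
  @power_concave R ('rV[R]_n * R^o)%type ((1 - q) / 2)%:E
    (closure Omega `*` `[0, +oo[)
    (fun z => u z.1 (z.2 ^+ 2)).
Proof.
have [oO _ _] := Omega_domain.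
have clO x : closure Omega x -> ~ Omega x -> boundary Omega x.
  by move=> cx nx; split => // /interior_subset.
have q1 : q < 1 by case/andP: hq.
(* From q > 1/3 the lower bound (3q - 1)/2 of p is positive. *)
have p0 : 0 < p by case/andP: hq; case/andP: hp; lra.
have pq : p < q by case/andP: hp.
(* The lower bound on p, rewritten as sigma < 1. *)
have hqp : q - p < (1 - q) / 2 by case/andP: hp; lra.
have u_ge0 : forall x t, closure Omega x -> 0 <= t -> 0 <= u x t.
  move=> x t cx; rewrite le_eqVlt => /predU1P[<-|t0]; first by rewrite u_initial.
  have [Ox|nOx] := pselect (Omega x); first exact/ltW/u_pos.
  by rewrite (u_lateral _ _ (clO _ cx nOx) (ltW t0)).
have vO x y (l : R) : Omega x -> Omega y -> 0 <= l <= 1 ->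
  Omega ((1 - l) *: x + l *: y) by exact: convex_setP.
have u_jet x t : Omega x -> 0 < t -> exists ut g D,
    jet_at u x t ut g D /\ ut - \sum_i D i = a x * u x t `^ p + u x t `^ q.
  move=> Ox t0; exists (derive1 (u x) t), (fun i => partial i (fun y => u y t) x),
    (fun i => partial i (partial i (fun y => u y t)) x).
  split; last by rewrite -u_eq.
  split=> [|i]; last exact: (Ck2_jet2 _ (fun y => u y t) _ _ oO (u_C2x _ t0) Ox).
  by rewrite derive1E; apply/derivableP; case: (u_C1t _ Ox) => + _; apply.
have O_sphere x : closure Omega x -> ~ Omega x -> exists y d,
    [/\ Omega y, 0 < d, eball y d `<=` Omega & sqdist y x <= d ^+ 2].
  move=> cx nx; have [y [d [Oy d0 dO [cb _]]]] := Omega_sphere _ (clO _ cx nx).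
  by exists y, d; split => //; exact: closure_eball_sqdist.
have a_pos x : Omega x -> 0 < a x by move=> /a_lower; exact: lt_le_trans.
have tE : ((q - p) / ((1 - q) / 2))^-1 = (1 - q) / (2 * (q - p)).
  by field; rewrite !subr_eq0 !gt_eqF.
have a_conc x y (l : R) : Omega x -> Omega y -> 0 <= l <= 1 ->
    (1 - l) * a x `^ ((q - p) / ((1 - q) / 2))^-1
      + l * a y `^ ((q - p) / ((1 - q) / 2))^-1
    <= a ((1 - l) *: x + l *: y) `^ ((q - p) / ((1 - q) / 2))^-1.
  move=> Ox Oy l01; rewrite tE.
  apply: (power_concave_le _ _ _ _ _ htheta a_pos a_concave) => //; last exact: vO.
  by rewrite divr_gt0 ?mulr_gt0 ?subr_gt0.
have cO := compact_closure _ Omega_bounded.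
split=> [[x s] [/= cx _]|]; first exact: u_ge0 _ _ cx (sqr_ge0 _).
split; first by rewrite divr_gt0 ?subr_gt0.
apply/concave_functionP => -[x s] [y t] l [/= cx] + [/= cy]; rewrite !in_itv /= !andbT.
move=> s0 t0 l01.
exact: (w_concave Omega p q m a u oO cO vO q1 p0 pq hqp u_jet u_cont u_pos
  (fun x t cx nx => u_lateral x t (clO x cx nx)) u_initial O_sphere m_pos a_lower
  a_conc x y s t l cx cy s0 t0 l01).
Qed.
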